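(* Let $\lambda^*=1$. For every $\Sigma_+^*$ and $\gamma$ taking values in the type IV loophole, i.e. $-\tfrac14<\Sigma_+^*<0$ and $$\gamma_0(\Sigma_+^* )<\gamma<\frac{6}{5+2\Sigma_+^*},$$ with $\gamma_0$ as defined in the context, there exists a closed periodic orbit of the reduced tilt system with parameters $\gamma,\Sigma_+^*,\lambda^*=1$ (see context).
   Context: Reduced tilt system. The variables are $x=v_1$, $\rho=v_2^2+v_3^2$ and the angle $\theta$ (mod $2\pi$) defined for $\rho>0$ by $2v_2v_3=\rho\sin\theta$, $v_2^2-v_3^2=\rho\cos\theta$, where $(v_1,v_2,v_3)\in\mathbb{R}^3$ is the tilt velocity, considered up to the symmetry $(v_2,v_3)\mapsto(-v_2,-v_3)$. The state space is $\rho\ge 0$, $V^2:=x^2+\rho\le 1$; at $\rho=0$ the angle $\theta$ has no meaning (all points with $\rho=0$ and the same $x$ are identified). The parameters $\gamma,\Sigma_+^*,\lambda^*$ and $A^*=1+\Sigma_+^*$, $N^*=\sqrt{-\Sigma_+^*(1+\Sigma_+^* )}$ are constants. The system is (prime $=d/d\tau$) $$x'=(T+2\Sigma_+^* )x-(A^*+\sqrt3N^*\cos\theta)\rho,$$ $$\rho'=2\left(T-\Sigma_+^*+A^*x-\alpha\cos\theta\right)\rho,$$ $$\theta'=2\alpha(\lambda^*+\sin\theta),$$ where $\alpha=\sqrt3(1-x)N^*$, $$T=\frac{\left[(3\gamma-4)-2(\gamma-1)A^*x\right](1-V^2)+(2-\gamma)V^2\mathcal{S}}{1-(\gamma-1)V^2},\qquad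 V^2\mathcal{S}=-2\Sigma_+^*x^2+\Sigma_+^*\rho+\sqrt3N^*\rho\cos\theta .$$ Definition of $\gamma_0$. Let $$F(\gamma,\Sigma_+)=\left[2(17\gamma^2-40\gamma+24)\Sigma_+-33\gamma^3+121\gamma^2-152\gamma+66\right]^2-9(\gamma-1)^2\left(121\gamma^4-736\gamma^3+1664\gamma^2-1656\gamma+612\right).$$ In the region $-\tfrac14<\Sigma_+<0$, $\frac{4+\Sigma_+}{3}<\gamma<\frac43$, the equation $F(\gamma,\Sigma_+)=0$ defines a curve in the $(\gamma,\Sigma_+)$ plane running from $(4/3,0)$ to $(4/3,-1/4)$; for given $\Sigma_+\in(-\tfrac14,0)$, $\gamma_0(\Sigma_+)$ denotes the value $\gamma\in\left(\frac{4+\Sigma_+}{3},\frac43\right)$ with $F(\gamma,\Sigma_+)=0$. (The loophole is the set of parameters $(\gamma,\Sigma_+^* )$ for which none of the type IV plane-wave equilibrium points is stable.) ''Closed periodic orbit'' means a periodic orbit which is not an equilibrium point. *)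

(* Defs.v *)
From Stdlib Require Export Reals.
From Coquelicot Require Export Coquelicot.
Local Open Scope R_scope.

(* A point of the reduced state space is (x, rho, theta); theta is an angle
   represented by a real number, read modulo 2 PI, and it is meaningless at
   rho = 0. *)
Record state := State { sx : R; srho : R; stheta : R }.

Definition Vsq (p : state) : R := sx p ^ 2 + srho p.

Definition in_state_space (p : state) : Prop := 0 <= srho p /\ Vsq p <= 1.

Definition same_point (p q : state) : Prop :=
  sx p = sx q /\ srho p = srho q /\
  (0 < srho p -> exists k : Z, stheta p = stheta q + 2 * PI * IZR k).

Section VectorField.

(* Sp stands for Sigma_+^* and lam for lambda^* *)
Variables gam Sp lam : R.

Definition Astar : R := 1 + Sp.

Definition Nstar : R := sqrt (- Sp * (1 + Sp)).

Definition alpha (p : state) : R := sqrt 3 * (1 - sx p) * Nstar.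

Definition VsqS (p : state) : R :=
  - 2 * Sp * sx p ^ 2 + Sp * srho p + sqrt 3 * Nstar * srho p * cos (stheta p).

Definition T (p : state) : R :=
  (((3 * gam - 4) - 2 * (gam - 1) * Astar * sx p) * (1 - Vsq p)
     + (2 - gam) * VsqS p)
  / (1 - (gam - 1) * Vsq p).

Definition x_rhs (p : state) : R :=
  (T p + 2 * Sp) * sx p - (Astar + sqrt 3 * Nstar * cos (stheta p)) * srho p.

Definition rho_rhs (p : state) : R :=
  2 * (T p - Sp + Astar * sx p - alpha p * cos (stheta p)) * srho p.

Definition theta_rhs (p : state) : R :=
  2 * alpha p * (lam + sin (stheta p)).

(* The theta-equation is imposed only where theta is meaningful. *)
Definition is_trajectory (phi : R -> state) : Prop :=
  forall t : R,
    in_state_space (phi t) /\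
    is_derive (fun s => sx (phi s)) t (x_rhs (phi t)) /\
    is_derive (fun s => srho (phi s)) t (rho_rhs (phi t)) /\
    (0 < srho (phi t) ->
       is_derive (fun s => stheta (phi s)) t (theta_rhs (phi t))).

Definition is_equilibrium (p : state) : Prop :=
  in_state_space p /\ x_rhs p = 0 /\ rho_rhs p = 0 /\
  (0 < srho p -> theta_rhs p = 0).

Definition is_closed_periodic_orbit (phi : R -> state) : Prop :=
  is_trajectory phi /\
  (exists P : R, 0 < P /\ forall t : R, same_point (phi (t + P)) (phi t)) /\
  (forall t : R, ~ is_equilibrium (phi t)).

End VectorField.

Definition F (gam Sp : R) : R :=
  (2 * (17 * gam ^ 2 - 40 * gam + 24) * Sp
     - 33 * gam ^ 3 + 121 * gam ^ 2 - 152 * gam + 66) ^ 2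
  - 9 * (gam - 1) ^ 2
      * (121 * gam ^ 4 - 736 * gam ^ 3 + 1664 * gam ^ 2 - 1656 * gam + 612).

(* g0 is the value gamma_0(Sp), for -1/4 < Sp < 0. *)
Definition is_gamma0 (Sp g0 : R) : Prop :=
  (4 + Sp) / 3 < g0 < 4 / 3 /\ F g0 Sp = 0.

(* Main.v *)
(** On the invariant plane theta = -PI/2 the substitution x = - v r, rho = r^2 (1 - v^2)
    turns the system into a planar one on the open unit square, with one equilibrium
    (vs, rs). The function
      Z = ln r - (1 - b)/2 ln (1 - r^2) + b ln (1 - v^2),  b = gamma - 1,
    satisfies Z' = 3 s (1 - 2 b) (vs^2 - v^2), s = - Sigma_+, so it is monotone on each side
    of the section v = vs; this forces every orbit other than the equilibrium to return
    to the section alternately from the two sides. The condition gamma > gamma_0 says that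
    the Jacobian at the equilibrium has positive trace, so it is a repeller and the return
    map moves points near it outwards; gamma < 6 / (5 + 2 Sigma_+) and a barrier near r = 1
    bound the return map away from r = 1. The return map is continuous, hence has a fixed
    point. *)
From Stdlib Require Import ZArith Lra Lia Psatz ClassicalEpsilon.
Require Import Defs.
Local Open Scope R_scope.

(** * Real functions of one variable *)

(** On [v = vs] the sign of [v'] is that of [r - rs], so orbits pass to the right above the
    equilibrium and to the left below it. An orbit that failed to come back would stay on one side
    for ever. Either [v] keeps away from [vs], and then Z drifts linearly and violates a bound, or
    [v] approaches [vs], and then the repelling equilibrium keeps [r] away from [rs], so that [v']
    has a definite size. The bounds on Z need care at the corner [v = r = 1], where its two
    logarithms tend to infinities of opposite sign. The condition gamma < 6 / (5 + 2 Sigma_+) says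
    exactly that the factor [growth], which carries the sign of [r'], is negative at that corner, so
    an orbit heading there must lose [r]. The upper bound for the return map does not depend on the
    starting point: the second half turn begins with [r] below [rs], and [r] can approach 1 only
    while [v] rises at a definite speed, for which there is room less than 1. Planar orbits are
    followed in forward time only; the closed one is continued to negative times by its period. *)

Lemma is_derive_continuous (g : R -> R) (t l : R) :
  is_derive g t l -> continuous g t.
Proof.
  intros H. apply (ex_derive_continuous (K := R_AbsRing) (V := R_NormedModule)).
  now exists l.
Qed.

Lemma derive_ge (g dg : R -> R) (a b m : R) :
  a <= b ->
  (forall t, a <= t <= b -> is_derive g t (dg t)) ->
  (forall t, a <= t <= b -> m <= dg t) ->
  g a + m * (b - a) <= g b.
Proof.
  intros hab hd hm.
  destruct (MVT_gen g a b dg) as [c [hc he]].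
  - rewrite Rmin_left, Rmax_right by lra. intros x hx. apply hd; lra.
  - rewrite Rmin_left, Rmax_right by lra. intros x hx.
    apply continuity_pt_filterlim. eapply is_derive_continuous, hd; lra.
  - rewrite Rmin_left, Rmax_right in hc by lra.
    specialize (hm c hc). nra.
Qed.

Lemma derive_le (g dg : R -> R) (a b m : R) :
  a <= b ->
  (forall t, a <= t <= b -> is_derive g t (dg t)) ->
  (forall t, a <= t <= b -> dg t <= m) ->
  g b <= g a + m * (b - a).
Proof.
  intros hab hd hm.
  assert (H := derive_ge (fun t => - g t) (fun t => - dg t) a b (- m) hab).
  cut (- g a + - m * (b - a) <= - g b); [lra|].
  apply H; intros t ht.
  - apply (is_derive_opp g t (dg t)), hd, ht.
  - specialize (hm t ht); lra.
Qed.

Lemma continuous_pos (g : R -> R) (t : R) :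
  continuous g t -> 0 < g t ->
  exists d, 0 < d /\ forall u, Rabs (u - t) < d -> 0 < g u.
Proof.
  intros hc hp.
  destruct (proj1 (filterlim_locally g (g t)) hc (mkposreal _ hp)) as [d hd].
  exists d; split; [apply cond_pos|].
  intros u hu. specialize (hd u hu).
  unfold ball in hd; simpl in hd; unfold AbsRing_ball, abs, minus, plus, opp in hd; simpl in hd.
  apply Rabs_def2 in hd. lra.
Qed.

(** The zero is the supremum of the times up to which [g] stays positive; continuity excludes either
    sign there. *)
Lemma first_zero (g : R -> R) (a b : R) :
  a <= b -> (forall t, a <= t <= b -> continuous g t) ->
  0 < g a -> g b <= 0 ->
  exists t0, a < t0 <= b /\ g t0 = 0 /\ forall t, a <= t < t0 -> 0 < g t.
Proof.
  intros hab hc ha hb.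
  set (E := fun t => a <= t <= b /\ forall u, a <= u <= t -> 0 < g u).
  destruct (completeness E) as [t0 [hub hlub]].
  - exists b. intros t [ht _]; lra.
  - exists a. split; [lra|]. intros u hu. replace u with a by lra. exact ha.
  - assert (hEa : E a) by (split; [lra|]; intros u hu; replace u with a by lra; exact ha).
    assert (h1 : a <= t0) by (apply hub, hEa).
    assert (h2 : t0 <= b) by (apply hlub; intros t [ht _]; lra).
    assert (hpos : forall t, a <= t < t0 -> 0 < g t).
    { intros t ht. destruct (Rlt_le_dec 0 (g t)) as [h|h]; [exact h|exfalso].
      assert (t0 <= t); [|lra].
      apply hlub. intros u [hu1 hu2].
      destruct (Rle_lt_dec u t) as [hh|hh]; [exact hh|].
      specialize (hu2 t); lra. }
    assert (hle : ~ 0 < g t0).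
    { intros hg. destruct (continuous_pos g t0) as [d [hd hd']]; [apply hc; lra|exact hg|].
      destruct (Req_dec t0 b) as [e|e]; [subst; lra|].
      assert (E (Rmin b (t0 + d / 2))).
      { assert (hm := Rmin_l b (t0 + d/2)). assert (hm' := Rmin_r b (t0 + d/2)).
        split; [split; [|exact hm]|].
        - apply Rmin_glb; lra.
        - intros u hu. destruct (Rlt_le_dec u t0) as [q|q]; [apply hpos; lra|].
          apply hd'. rewrite Rabs_right; lra. }
      assert (hq := hub _ H).
      assert (t0 < Rmin b (t0 + d / 2)); [|lra].
      apply Rmin_glb_lt; lra. }
    assert (hge : ~ g t0 < 0).
    { intros hg. destruct (continuous_pos (fun t => - g t) t0) as [d [hd hd']].
      - apply (continuous_opp g), hc; lra.
      - lra.
      - destruct (Req_dec t0 a) as [e|e]; [subst; lra|].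
        set (u := Rmax a (t0 - d/2)).
        assert (hu1 : a <= u) by apply Rmax_l.
        assert (hu2 : t0 - d/2 <= u) by apply Rmax_r.
        assert (hu3 : u < t0) by (apply Rmax_lub_lt; lra).
        assert (0 < - g u) by (apply hd'; rewrite Rabs_left; lra).
        assert (0 < g u) by (apply hpos; lra). lra. }
    exists t0. repeat split; try lra; auto.
    destruct (Req_dec t0 a) as [e|e]; [subst; exfalso; lra|lra].
Qed.

Lemma last_zero (g : R -> R) (a b : R) :
  a <= b -> (forall t, a <= t <= b -> continuous g t) ->
  0 <= g a -> g b < 0 ->
  exists t0, a <= t0 < b /\ g t0 = 0 /\ forall t, t0 < t <= b -> g t < 0.
Proof.
  intros hab hc ha hb.
  destruct (first_zero (fun t => - g (- t)) (- b) (- a)) as [t0 [h1 [h2 h3]]].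
  - lra.
  - intros t ht.
    apply (continuous_opp (fun u => g (- u))).
    apply (continuous_comp Ropp g).
    + apply (continuous_opp (fun u : R => u)), continuous_id.
    + apply hc; lra.
  - replace (- - b) with b by ring; lra.
  - replace (- - a) with a by ring; lra.
  - exists (- t0). repeat split; try lra.
    intros t ht. specialize (h3 (- t)). rewrite Ropp_involutive in h3. lra.
Qed.

(** After its last time at level [q] the function would lie below that level, where its derivative
    is nonnegative. A weak inequality imposed at the level alone would not suffice, hence the whole
    sublevel set. *)
Lemma barrier (g dg : R -> R) (q a b : R) :
  a <= b ->
  (forall t, a <= t <= b -> is_derive g t (dg t)) ->
  (forall t, a <= t <= b -> g t <= q -> 0 <= dg t) ->
  q <= g a -> q <= g b.
Proof.
  intros hab hd hp ha.
  destruct (Rle_lt_dec q (g b)) as [h|h]; [exact h|exfalso].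
  destruct (last_zero (fun t => g t - q) a b) as [t0 [h1 [h2 h3]]]; try lra.
  - intros t ht. apply (continuous_minus g (fun _ => q)).
    + eapply is_derive_continuous, hd, ht.
    + apply continuous_const.
  - assert (g t0 + 0 * (b - t0) <= g b); [|lra].
    apply derive_ge with dg; [lra| |]; intros t ht.
    + apply hd; lra.
    + apply hp; [lra|]. destruct (Req_dec t t0) as [e|e]; [subst; lra|].
      specialize (h3 t); lra.
Qed.

Lemma derive_pos_right (g : R -> R) (t l : R) :
  is_derive g t l -> 0 < l ->
  exists d, 0 < d /\ forall u, t < u < t + d -> g t < g u.
Proof.
  intros hd hl.
  apply is_derive_Reals in hd.
  destruct (hd (l / 2)) as [d hd']; [lra|].
  exists d; split; [apply cond_pos|]. intros u hu.
  specialize (hd' (u - t)).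
  replace (t + (u - t)) with u in hd' by ring.
  assert (H : Rabs ((g u - g t) / (u - t) - l) < l / 2).
  { apply hd'; [lra|]. rewrite Rabs_right; lra. }
  apply Rabs_def2 in H.
  assert (h : 0 < (g u - g t) / (u - t)) by lra.
  apply (Rmult_lt_compat_r (u - t)) in h; [|lra].
  unfold Rdiv in h. rewrite Rmult_assoc, Rinv_l, Rmult_1_r in h by lra. lra.
Qed.

Lemma derive_pos_left (g : R -> R) (t l : R) :
  is_derive g t l -> 0 < l ->
  exists d, 0 < d /\ forall u, t - d < u < t -> g u < g t.
Proof.
  intros hd hl.
  apply is_derive_Reals in hd.
  destruct (hd (l / 2)) as [d hd']; [lra|].
  exists d; split; [apply cond_pos|]. intros u hu.
  specialize (hd' (u - t)).
  replace (t + (u - t)) with u in hd' by ring.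
  assert (H : Rabs ((g u - g t) / (u - t) - l) < l / 2).
  { apply hd'; [lra|]. rewrite Rabs_left; lra. }
  apply Rabs_def2 in H.
  assert (h : 0 < (g u - g t) / (u - t)) by lra.
  apply (Rmult_lt_compat_r (t - u)) in h; [|lra].
  replace ((g u - g t) / (u - t) * (t - u)) with (- (g u - g t)) in h by (field; lra).
  lra.
Qed.

(** A strict sign allows the condition to be imposed on the level only: just after the last zero [g]
    would have to be positive. This suits the nullcline of [v], where the sign is known on the curve
    itself. *)
Lemma barrier_strict (g dg : R -> R) (a b : R) :
  a <= b ->
  (forall t, a <= t <= b -> is_derive g t (dg t)) ->
  (forall t, a <= t <= b -> g t = 0 -> 0 < dg t) ->
  0 <= g a -> 0 <= g b.
Proof.
  intros hab hd hp ha.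
  destruct (Rle_lt_dec 0 (g b)) as [h|h]; [exact h|exfalso].
  destruct (last_zero g a b) as [t0 [h1 [h2 h3]]]; try lra.
  - intros t ht. eapply is_derive_continuous, hd, ht.
  - destruct (derive_pos_right g t0 (dg t0)) as [d [hd1 hd2]].
    + apply hd; lra.
    + apply hp; lra.
    + set (u := Rmin b (t0 + d / 2)).
      assert (u <= b) by apply Rmin_l.
      assert (u <= t0 + d/2) by apply Rmin_r.
      assert (t0 < u) by (apply Rmin_glb_lt; lra).
      specialize (h3 u). specialize (hd2 u). lra.
Qed.

Lemma Rabs_le_of_sq x y : 0 <= y -> x ^ 2 <= y ^ 2 -> Rabs x <= y.
Proof.
  intros hy h. rewrite <- (Rabs_right y) by lra. apply Rsqr_le_abs_0.
  unfold Rsqr. simpl in h. lra.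
Qed.

(** * The Cauchy problem for a bounded Lipschitz planar field *)

Lemma is_derive_constant (a t : R) : is_derive (fun _ : R => a) t 0.
Proof. apply (is_derive_const (K := R_AbsRing) (V := R_NormedModule)). Qed.

Lemma lipschitz_continuous (h : R -> R) (L : R) :
  (forall x y, Rabs (h x - h y) <= L * Rabs (x - y)) -> forall x, continuous h x.
Proof.
  intros hL x. apply filterlim_locally. intros eps.
  assert (hL0 : 0 <= L).
  { specialize (hL 1 0). rewrite Rminus_0_r, Rabs_R1 in hL.
    assert (q := Rabs_pos (h 1 - h 0)). lra. }
  assert (hp : 0 < eps / (L + 1)) by (apply Rdiv_lt_0_compat; [apply cond_pos|lra]).
  exists (mkposreal _ hp). intros y hy.
  change (Rabs (h y - h x) < eps). change (Rabs (y - x) < eps / (L + 1)) in hy.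
  apply Rle_lt_trans with (1 := hL y x).
  apply (Rmult_lt_compat_r (L + 1)) in hy; [|lra].
  replace (eps / (L + 1) * (L + 1)) with (pos eps) in hy by (field; lra).
  assert (q := Rabs_pos (y - x)). nra.
Qed.

Lemma le_of_le_half_pow (x C : R) : (forall n : nat, x <= C * (1 / 2) ^ n) -> x <= 0.
Proof.
  intros H.
  assert (hl : is_lim_seq (fun n => C * (1 / 2) ^ n) 0).
  { replace (Finite 0) with (Rbar_mult (Finite C) (Finite 0)) by (simpl; f_equal; ring).
    apply is_lim_seq_scal_l, is_lim_seq_geom. rewrite Rabs_right; lra. }
  assert (H1 := is_lim_seq_le (fun _ => x) _ x 0 H (is_lim_seq_const x) hl).
  exact H1.
Qed.

Lemma abs_le_of_half_pow (x y C : R) :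
  (forall n : nat, Rabs (x - y) <= C * (1 / 2) ^ n) -> x = y.
Proof.
  intros H. apply le_of_le_half_pow in H.
  assert (q := Rabs_pos (x - y)).
  apply Rminus_diag_uniq. destruct (Req_dec (x - y) 0) as [e|e]; [exact e|].
  apply Rabs_pos_lt in e. lra.
Qed.

Lemma Lim_seq_half_pow (u : nat -> R) (C : R) :
  (forall n, Rabs (u (S n) - u n) <= C * (1 / 2) ^ n) ->
  forall n, Rabs (real (Lim_seq u) - u n) <= 2 * C * (1 / 2) ^ n.
Proof.
  intros hu.
  assert (hC : 0 <= C).
  { specialize (hu 0%nat). simpl in hu. assert (q := Rabs_pos (u 1%nat - u 0%nat)). lra. }
  (* The factor [1 - (1 / 2) ^ m] is the exact partial geometric sum; with it the induction
     closes. *)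
  assert (hb : forall n m, Rabs (u (m + n)%nat - u n) <= 2 * C * (1 / 2) ^ n * (1 - (1 / 2) ^ m)).
  { intros n m. induction m as [|m IH].
    - simpl. rewrite Rminus_diag, Rabs_R0. lra.
    - replace (u (S m + n)%nat - u n)
        with ((u (S (m + n)) - u (m + n)%nat) + (u (m + n)%nat - u n)) by (simpl; ring).
      apply Rle_trans with (1 := Rabs_triang _ _).
      specialize (hu (m + n)%nat). rewrite pow_add in hu. simpl pow. nra. }
  assert (hb' : forall n m, (n <= m)%nat -> Rabs (u m - u n) <= 2 * C * (1 / 2) ^ n).
  { intros n m hnm. replace m with ((m - n) + n)%nat by lia.
    apply Rle_trans with (1 := hb n (m - n)%nat).
    assert (0 < (1/2) ^ n) by (apply pow_lt; lra).
    assert (0 < (1/2) ^ (m - n)) by (apply pow_lt; lra).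
    assert (0 <= 2 * C * (1/2)^n) by nra. nra. }
  assert (hl : is_lim_seq u (real (Lim_seq u))).
  { assert (h : ex_finite_lim_seq u).
    { apply ex_lim_seq_cauchy_corr. intros eps.
      assert (hg : is_lim_seq (fun n => 2 * C * (1 / 2) ^ n) 0).
      { replace (Finite 0) with (Rbar_mult (Finite (2 * C)) (Finite 0)) by (simpl; f_equal; ring).
        apply is_lim_seq_scal_l, is_lim_seq_geom. rewrite Rabs_right; lra. }
      apply is_lim_seq_spec in hg.
      destruct (hg (pos_div_2 eps)) as [N hN]. specialize (hN N (le_n N)).
      rewrite Rminus_0_r in hN. simpl in hN. apply Rabs_def2 in hN.
      exists N. intros n m hn hm.
      replace (u n - u m) with ((u n - u N) - (u m - u N)) by ring.
      apply Rle_lt_trans with (1 := Rabs_triang _ _). rewrite Rabs_Ropp.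
      assert (h1 := hb' N n hn). assert (h2 := hb' N m hm). lra. }
    destruct h as [l hl]. rewrite (is_lim_seq_unique _ _ hl). exact hl. }
  intros n.
  assert (H := is_lim_seq_le_loc (fun m => Rabs (u m - u n)) (fun _ => 2 * C * (1/2)^n)
     (Rabs (real (Lim_seq u) - u n)) (2 * C * (1/2)^n)).
  apply H.
  - exists n. intros m hm. now apply hb'.
  - apply (is_lim_seq_abs (fun m => u m - u n) (Finite (real (Lim_seq u) - u n))).
    apply is_lim_seq_minus'; [exact hl|apply is_lim_seq_const].
  - apply is_lim_seq_const.
Qed.

Lemma abs_le_exp (D dD : R -> R) (C k t : R) :
  0 < k -> 0 <= t -> D 0 = 0 -> 0 <= C ->
  (forall s, 0 <= s <= t -> is_derive D s (dD s)) ->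
  (forall s, 0 <= s <= t -> Rabs (dD s) <= C * exp (k * s)) ->
  Rabs (D t) <= C / k * exp (k * t).
Proof.
  intros hk ht h0 hC hd hb.
  assert (aux : forall G dG : R -> R, G 0 = 0 ->
     (forall s, 0 <= s <= t -> is_derive G s (dG s)) ->
     (forall s, 0 <= s <= t -> dG s <= C * exp (k * s)) ->
     G t <= C / k * exp (k * t)).
  { intros G dG g0 hG hGb.
    assert (H := derive_le (fun s => G s - C / k * exp (k * s))
               (fun s => dG s - C * exp (k * s)) 0 t 0 ht).
    assert (H0 : G t - C / k * exp (k * t) <= G 0 - C / k * exp (k * 0) + 0 * (t - 0)).
    { apply H; intros s hs.
      - apply (is_derive_minus G (fun s => C / k * exp (k * s))); [now apply hG|].
        auto_derive; [exact I|]. field. lra.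
      - specialize (hGb s hs). lra. }
    rewrite g0, Rmult_0_r, exp_0 in H0.
    assert (0 <= C / k) by (apply Rdiv_le_0_compat; lra). lra. }
  apply Rabs_le. split.
  - cut (- D t <= C / k * exp (k * t)); [lra|].
    apply (aux (fun s => - D s) (fun s => - dD s)); [lra| |].
    + intros s hs. apply (is_derive_opp D s (dD s)), hd, hs.
    + intros s hs. specialize (hb s hs). apply Rabs_le_between in hb. lra.
  - apply (aux D dD); [exact h0|exact hd|].
    intros s hs. specialize (hb s hs). apply Rabs_le_between in hb. lra.
Qed.

Definition lipschitz2 (f : R -> R -> R) (L : R) : Prop :=
  (forall a b, Rabs (f a b) <= L) /\
  (forall a b a' b', Rabs (f a b - f a' b') <= L * (Rabs (a - a') + Rabs (b - b'))).

Lemma abs_lip (t u : R) : Rabs (Rabs t - Rabs u) <= Rabs (t - u).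
Proof. apply Rabs_triang_inv2. Qed.

(* Integrating along [Rabs s] makes every iterate differentiable on the whole
   line, although only times [t >= 0] matter. *)
Definition picard_step (f : R -> R -> R) (a : R) (y z : R -> R) (t : R) : R :=
  a + RInt (fun s => f (y (Rabs s)) (z (Rabs s))) 0 t.

Definition lip1 (L : R) (y : R -> R) : Prop :=
  forall t u, Rabs (y t - y u) <= L * Rabs (t - u).

Section Picard.

Variables (f1 f2 : R -> R -> R) (L a0 b0 : R).
Hypotheses (hL : 0 < L) (h1 : lipschitz2 f1 L) (h2 : lipschitz2 f2 L).

Lemma picard_step_derive (f : R -> R -> R) (a : R) (y z : R -> R) (t : R) :
  lipschitz2 f L -> lip1 L y -> lip1 L z ->
  is_derive (picard_step f a y z) t (f (y (Rabs t)) (z (Rabs t))).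
Proof.
  intros [hb hf] hy hz.
  assert (hc : forall s, continuous (fun s => f (y (Rabs s)) (z (Rabs s))) s).
  { apply lipschitz_continuous with (L * (L + L)). intros s u.
    apply Rle_trans with (1 := hf _ _ _ _).
    assert (q1 := hy (Rabs s) (Rabs u)). assert (q2 := hz (Rabs s) (Rabs u)).
    assert (q3 := abs_lip s u).
    assert (L * Rabs (Rabs s - Rabs u) <= L * Rabs (s - u)) by (apply Rmult_le_compat_l; lra).
    rewrite Rmult_assoc. apply Rmult_le_compat_l; lra. }
  unfold picard_step.
  replace (f (y (Rabs t)) (z (Rabs t))) with (0 + f (y (Rabs t)) (z (Rabs t))) by ring.
  apply (is_derive_plus (fun _ => a)).
  - apply is_derive_constant.
  - apply (is_derive_RInt (fun s => f (y (Rabs s)) (z (Rabs s))) _ 0); [|apply hc].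
    exists (mkposreal 1 Rlt_0_1). intros u _.
    apply (RInt_correct (V := R_CompleteNormedModule)).
    apply (ex_RInt_continuous (V := R_CompleteNormedModule)). intros; apply hc.
Qed.

Lemma picard_step_0 (f : R -> R -> R) (a : R) (y z : R -> R) : picard_step f a y z 0 = a.
Proof. unfold picard_step. rewrite RInt_point. unfold zero; simpl. ring. Qed.

Lemma picard_step_lip (f : R -> R -> R) (a : R) (y z : R -> R) :
  lipschitz2 f L -> lip1 L y -> lip1 L z -> lip1 L (picard_step f a y z).
Proof.
  intros hf hy hz.
  assert (H : forall t u, t <= u ->
    Rabs (picard_step f a y z t - picard_step f a y z u) <= L * Rabs (t - u)).
  { intros t u htu.
    assert (q1 := derive_ge (picard_step f a y z) _ t u (- L) htu
      (fun s _ => picard_step_derive f a y z s hf hy hz)).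
    assert (q2 := derive_le (picard_step f a y z) _ t u L htu
      (fun s _ => picard_step_derive f a y z s hf hy hz)).
    assert (hb : forall s, - L <= f (y (Rabs s)) (z (Rabs s)) <= L).
    { intros s. apply Rabs_le_between, (proj1 hf). }
    rewrite (Rabs_left1 (t - u)) by lra.
    apply Rabs_le. split.
    - assert (q := q2 (fun s _ => proj2 (hb s))). lra.
    - assert (q := q1 (fun s _ => proj1 (hb s))). lra. }
  intros t u. destruct (Rle_lt_dec t u) as [h|h]; [now apply H|].
  rewrite Rabs_minus_sym, (Rabs_minus_sym t u). apply H. lra.
Qed.

Fixpoint picard (n : nat) : (R -> R) * (R -> R) :=
  match n with
  | O => (fun _ => a0, fun _ => b0)
  | S n => (picard_step f1 a0 (fst (picard n)) (snd (picard n)),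
            picard_step f2 b0 (fst (picard n)) (snd (picard n)))
  end.

Lemma picard_lip n : lip1 L (fst (picard n)) /\ lip1 L (snd (picard n)).
Proof.
  induction n as [|n [IH1 IH2]]; simpl.
  - split; intros t u; rewrite Rminus_diag, Rabs_R0; apply Rmult_le_pos; try lra; apply Rabs_pos.
  - split; now apply picard_step_lip.
Qed.

(** Contraction in the norm weighted by [exp (4 * L * t)]: the integrands differ by at most
    [2 * L * C * exp (4 * L * s)], and integration divides by [4 * L]. The weight gives all times
    [t >= 0] at once, without gluing local solutions. *)
Lemma picard_step_diff (f : R -> R -> R) (a : R) (y z y' z' : R -> R) (C t : R) :
  lipschitz2 f L -> lip1 L y -> lip1 L z -> lip1 L y' -> lip1 L z' ->
  0 <= t -> 0 <= C ->
  (forall s, 0 <= s -> Rabs (y s - y' s) <= C * exp (4 * L * s)) ->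
  (forall s, 0 <= s -> Rabs (z s - z' s) <= C * exp (4 * L * s)) ->
  Rabs (picard_step f a y z t - picard_step f a y' z' t) <= C * (1 / 2) * exp (4 * L * t).
Proof.
  intros hf hy hz hy' hz' ht hC hd1 hd2.
  replace (C * (1 / 2)) with (2 * L * C / (4 * L)) by (field; lra).
  apply (abs_le_exp (fun t => picard_step f a y z t - picard_step f a y' z' t)
    (fun s => f (y (Rabs s)) (z (Rabs s)) - f (y' (Rabs s)) (z' (Rabs s)))); try lra.
  - rewrite !picard_step_0. ring.
  - apply Rmult_le_pos; lra.
  - intros s hs. apply (is_derive_minus (picard_step f a y z) (picard_step f a y' z'));
      now apply picard_step_derive.
  - intros s hs. rewrite (Rabs_right s) by lra.
    apply Rle_trans with (1 := proj2 hf _ _ _ _).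
    assert (q1 := hd1 s (proj1 hs)). assert (q2 := hd2 s (proj1 hs)). nra.
Qed.

Lemma picard_diff n t : 0 <= t ->
  Rabs (fst (picard (S n)) t - fst (picard n) t) <= exp (4 * L * t) * (1 / 2) ^ n /\
  Rabs (snd (picard (S n)) t - snd (picard n) t) <= exp (4 * L * t) * (1 / 2) ^ n.
Proof.
  revert t. induction n as [|n IH]; intros t ht.
  - assert (aux : forall f a, lipschitz2 f L ->
      Rabs (picard_step f a (fun _ => a0) (fun _ => b0) t - a) <= exp (4 * L * t) * 1).
    { intros f a hf.
      assert (hl : forall k : R, lip1 L (fun _ => k)).
      { intros k u v. rewrite Rminus_diag, Rabs_R0. apply Rmult_le_pos; [lra|apply Rabs_pos]. }
      apply Rle_trans with (L / (4 * L) * exp (4 * L * t)).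
      - apply (abs_le_exp (fun t => picard_step f a (fun _ => a0) (fun _ => b0) t - a)
          (fun _ => f a0 b0)); try lra.
        + rewrite picard_step_0. ring.
        + intros s hs. rewrite <- (Rminus_0_r (f a0 b0)).
          apply (is_derive_minus (picard_step f a (fun _ => a0) (fun _ => b0)) (fun _ => a)).
          * now apply (picard_step_derive f a (fun _ => a0) (fun _ => b0) s).
          * apply is_derive_constant.
        + intros s hs. apply Rle_trans with L; [apply (proj1 hf)|].
          assert (1 <= exp (4 * L * s)); [|nra].
          assert (q := exp_ineq1_le (4 * L * s)). nra.
      - replace (L / (4 * L)) with (1/4) by (field; lra).
        assert (q := exp_pos (4 * L * t)). lra. }
    simpl. split; now apply aux.
  - assert (hC : 0 <= (1 / 2) ^ n) by (apply pow_le; lra).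
    destruct (picard_lip n) as [l1 l2]. destruct (picard_lip (S n)) as [l3 l4].
    assert (e : exp (4 * L * t) * (1 / 2) ^ S n = (1/2)^n * (1/2) * exp (4 * L * t))
      by (simpl; ring).
    rewrite e. clear e. split.
    + apply (picard_step_diff f1 a0); auto; intros s hs; rewrite Rmult_comm; now apply IH.
    + apply (picard_step_diff f2 b0); auto; intros s hs; rewrite Rmult_comm; now apply IH.
Qed.

Theorem picard_lindelof : exists y z : R -> R, y 0 = a0 /\ z 0 = b0 /\
  forall t, 0 <= t ->
    is_derive y t (f1 (y t) (z t)) /\ is_derive z t (f2 (y t) (z t)).
Proof.
  set (y := fun t => real (Lim_seq (fun n => fst (picard n) (Rabs t)))).
  set (z := fun t => real (Lim_seq (fun n => snd (picard n) (Rabs t)))).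
  assert (hy : forall t n, Rabs (y t - fst (picard n) (Rabs t))
      <= 2 * exp (4 * L * Rabs t) * (1 / 2) ^ n).
  { intros t n. apply (Lim_seq_half_pow (fun n => fst (picard n) (Rabs t))).
    intros m. apply picard_diff, Rabs_pos. }
  assert (hz : forall t n, Rabs (z t - snd (picard n) (Rabs t))
      <= 2 * exp (4 * L * Rabs t) * (1 / 2) ^ n).
  { intros t n. apply (Lim_seq_half_pow (fun n => snd (picard n) (Rabs t))).
    intros m. apply picard_diff, Rabs_pos. }
  assert (aux : forall (w : R -> R) (p : nat -> R -> R), (forall n, lip1 L (p n)) ->
     (forall t n, Rabs (w t - p n (Rabs t)) <= 2 * exp (4 * L * Rabs t) * (1 / 2) ^ n) ->
     lip1 L w).
  { intros w p hp hw t u.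
    cut (Rabs (w t - w u) - L * Rabs (t - u) <= 0); [lra|].
    apply le_of_le_half_pow with (2 * exp (4 * L * Rabs t) + 2 * exp (4 * L * Rabs u)).
    intros n. assert (q1 := hw t n). assert (q2 := hw u n).
    assert (q3 := hp n (Rabs t) (Rabs u)).
    assert (q4 := abs_lip t u).
    apply (Rmult_le_compat_l L) in q4; [|lra].
    rewrite Rabs_minus_sym in q2.
    assert (q5 := Rabs_triang (w t - p n (Rabs t)) (p n (Rabs t) - w u)).
    assert (q6 := Rabs_triang (p n (Rabs t) - p n (Rabs u)) (p n (Rabs u) - w u)).
    replace (w t - p n (Rabs t) + (p n (Rabs t) - w u)) with (w t - w u) in q5 by ring.
    replace (p n (Rabs t) - p n (Rabs u) + (p n (Rabs u) - w u)) with (p n (Rabs t) - w u)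
      in q6 by ring.
    lra. }
  assert (ly : lip1 L y) by (apply (aux y (fun n => fst (picard n))); [intros; apply picard_lip|exact hy]).
  assert (lz : lip1 L z) by (apply (aux z (fun n => snd (picard n))); [intros; apply picard_lip|exact hz]).
  assert (fix_aux : forall f a (w : R -> R) (p : nat -> R -> R), lipschitz2 f L ->
     (forall t n, Rabs (w t - p n (Rabs t)) <= 2 * exp (4 * L * Rabs t) * (1 / 2) ^ n) ->
     (forall n, p (S n) = picard_step f a (fst (picard n)) (snd (picard n))) ->
     forall t, 0 <= t -> picard_step f a y z t = w t).
  { intros f a w p hf hw hp t ht.
    apply abs_le_of_half_pow with (2 * exp (4 * L * t)). intros n.
    assert (q1 := hw t (S n)). rewrite (Rabs_right t), hp in q1 by lra.
    destruct (picard_lip n) as [l1 l2].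
    assert (hC : 0 <= (1 / 2) ^ n) by (apply pow_le; lra).
    assert (q2 : Rabs (picard_step f a y z t
       - picard_step f a (fst (picard n)) (snd (picard n)) t)
       <= 2 * (1 / 2) ^ n * (1 / 2) * exp (4 * L * t)).
    { apply picard_step_diff; auto; try lra; intros s hs.
      - assert (q := hy s n). rewrite (Rabs_right s) in q by lra. lra.
      - assert (q := hz s n). rewrite (Rabs_right s) in q by lra. lra. }
    rewrite Rabs_minus_sym in q1.
    assert (q5 := Rabs_triang (picard_step f a y z t
       - picard_step f a (fst (picard n)) (snd (picard n)) t)
       (picard_step f a (fst (picard n)) (snd (picard n)) t - w t)).
    simpl pow in q1.
    match goal with h : Rabs ?u <= _ + _ |- Rabs ?v <= _ => replace u with v in h by ring end.
    lra. }
  (* The limits [y] and [z] are even functions of [t] and in general have a corner at 0. One more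
     Picard step agrees with them for [t >= 0] and is differentiable on both sides of 0. *)
  exists (picard_step f1 a0 y z), (picard_step f2 b0 y z).
  rewrite !picard_step_0. split; [reflexivity|]. split; [reflexivity|].
  intros t ht.
  rewrite (fix_aux f1 a0 y (fun n => fst (picard n)) h1 hy (fun _ => eq_refl) t ht).
  rewrite (fix_aux f2 b0 z (fun n => snd (picard n)) h2 hz (fun _ => eq_refl) t ht).
  rewrite <- (Rabs_right t) at 2 3 5 6 by lra.
  split; now apply picard_step_derive.
Qed.

(** The squared distance times [exp (- (4 * L) * t)] does not increase, since its growth rate is at
    most [2 * L * (|p| + |r|)^2 <= 4 * L * (p^2 + r^2)]. *)
Theorem gronwall (y z y' z' : R -> R) (t : R) :
  0 <= t ->
  (forall s, 0 <= s -> is_derive y s (f1 (y s) (z s)) /\ is_derive z s (f2 (y s) (z s))) ->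
  (forall s, 0 <= s -> is_derive y' s (f1 (y' s) (z' s)) /\ is_derive z' s (f2 (y' s) (z' s))) ->
  (y t - y' t) ^ 2 + (z t - z' t) ^ 2
    <= ((y 0 - y' 0) ^ 2 + (z 0 - z' 0) ^ 2) * exp (4 * L * t).
Proof.
  intros ht hs hs'.
  set (G := fun t => ((y t - y' t) ^ 2 + (z t - z' t) ^ 2) * exp (- (4 * L) * t)).
  set (dG := fun t =>
    (2 * (y t - y' t) * (f1 (y t) (z t) - f1 (y' t) (z' t))
     + 2 * (z t - z' t) * (f2 (y t) (z t) - f2 (y' t) (z' t))) * exp (- (4 * L) * t)
    + ((y t - y' t) ^ 2 + (z t - z' t) ^ 2) * (- (4 * L) * exp (- (4 * L) * t))).
  assert (H : G t <= G 0 + 0 * (t - 0)).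
  { apply derive_le with dG; [exact ht| |]; intros s hst.
    - destruct (hs s (proj1 hst)) as [d1 d2]. destruct (hs' s (proj1 hst)) as [d3 d4].
      unfold G, dG. auto_derive.
      + repeat split; eexists; eassumption.
      + replace (Derive (fun x => y x) s) with (f1 (y s) (z s)) by (symmetry; apply is_derive_unique, d1).
        replace (Derive (fun x => z x) s) with (f2 (y s) (z s)) by (symmetry; apply is_derive_unique, d2).
        replace (Derive (fun x => y' x) s) with (f1 (y' s) (z' s)) by (symmetry; apply is_derive_unique, d3).
        replace (Derive (fun x => z' x) s) with (f2 (y' s) (z' s)) by (symmetry; apply is_derive_unique, d4).
        ring.
    - unfold dG.
      assert (q1 := proj2 h1 (y s) (z s) (y' s) (z' s)).
      assert (q2 := proj2 h2 (y s) (z s) (y' s) (z' s)).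
      set (p := y s - y' s) in *. set (r := z s - z' s) in *.
      set (g1 := f1 (y s) (z s) - f1 (y' s) (z' s)) in *.
      set (g2 := f2 (y s) (z s) - f2 (y' s) (z' s)) in *.
      assert (hE := exp_pos (- (4 * L) * s)).
      assert (key : 2 * p * g1 + 2 * r * g2 <= 4 * L * (p ^ 2 + r ^ 2)).
      { assert (p * g1 <= Rabs p * (L * (Rabs p + Rabs r))).
        { apply Rle_trans with (1 := Rle_abs _). rewrite Rabs_mult.
          apply Rmult_le_compat_l; [apply Rabs_pos|exact q1]. }
        assert (r * g2 <= Rabs r * (L * (Rabs p + Rabs r))).
        { apply Rle_trans with (1 := Rle_abs _). rewrite Rabs_mult.
          apply Rmult_le_compat_l; [apply Rabs_pos|exact q2]. }
        rewrite <- (pow2_abs p), <- (pow2_abs r).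
        assert (0 <= L * (Rabs p - Rabs r) ^ 2) by (apply Rmult_le_pos; [lra|apply pow2_ge_0]).
        nra. }
      nra. }
  unfold G in H. rewrite Rmult_0_r, exp_0 in H.
  assert (hE := exp_pos (4 * L * t)).
  replace (- (4 * L) * t) with (- (4 * L * t)) in H by ring.
  rewrite exp_Ropp in H.
  apply (Rmult_le_compat_r (exp (4 * L * t))) in H; [|lra].
  rewrite Rmult_assoc, Rinv_l in H by lra. lra.
Qed.

End Picard.

(** * The planar system *)

(** Boundedness is included so that the class is closed under products; the field can then be
    handled by its syntax. *)
Definition bounded_lipschitz (f : R -> R -> R) : Prop := exists L, 0 < L /\ lipschitz2 f L.

Lemma lipschitz2_weaken f L L' : L <= L' -> lipschitz2 f L -> lipschitz2 f L'.
Proof.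
  intros hL [hb hl]. split; intros a b.
  - specialize (hb a b). lra.
  - intros a' b'. specialize (hl a b a' b').
    assert (q1 := Rabs_pos (a - a')). assert (q2 := Rabs_pos (b - b')). nra.
Qed.

Lemma bounded_lipschitz_const k : bounded_lipschitz (fun _ _ => k).
Proof.
  assert (q := Rabs_pos k).
  exists (Rabs k + 1). split; [lra|]. split; [intros; lra|].
  intros a b a' b'. rewrite Rminus_diag, Rabs_R0.
  assert (q1 := Rabs_pos (a - a')). assert (q2 := Rabs_pos (b - b')). nra.
Qed.

Lemma bounded_lipschitz_plus f g :
  bounded_lipschitz f -> bounded_lipschitz g -> bounded_lipschitz (fun a b => f a b + g a b).
Proof.
  intros [L [hL [hb hl]]] [L' [hL' [hb' hl']]].
  exists (L + L'). split; [lra|]. split.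
  - intros a b. specialize (hb a b). specialize (hb' a b).
    assert (q := Rabs_triang (f a b) (g a b)). lra.
  - intros a b a' b'. specialize (hl a b a' b'). specialize (hl' a b a' b').
    assert (q := Rabs_triang (f a b - f a' b') (g a b - g a' b')).
    replace (f a b + g a b - (f a' b' + g a' b'))
      with (f a b - f a' b' + (g a b - g a' b')) by ring. lra.
Qed.

Lemma bounded_lipschitz_mult f g :
  bounded_lipschitz f -> bounded_lipschitz g -> bounded_lipschitz (fun a b => f a b * g a b).
Proof.
  intros [L [hL [hb hl]]] [L' [hL' [hb' hl']]].
  assert (hp : 0 < L * L') by now apply Rmult_lt_0_compat.
  exists (2 * (L * L')). split; [lra|]. split.
  - intros a b. rewrite Rabs_mult.
    assert (Rabs (f a b) * Rabs (g a b) <= L * L'); [|lra].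
    apply Rmult_le_compat; auto; apply Rabs_pos.
  - intros a b a' b'.
    replace (f a b * g a b - f a' b' * g a' b')
      with (f a b * (g a b - g a' b') + (f a b - f a' b') * g a' b') by ring.
    apply Rle_trans with (1 := Rabs_triang _ _). rewrite !Rabs_mult.
    assert (Rabs (f a b) * Rabs (g a b - g a' b') <= L * (L' * (Rabs (a - a') + Rabs (b - b'))))
      by (apply Rmult_le_compat; auto; apply Rabs_pos).
    assert (Rabs (f a b - f a' b') * Rabs (g a' b') <= (L * (Rabs (a - a') + Rabs (b - b'))) * L')
      by (apply Rmult_le_compat; auto; apply Rabs_pos).
    lra.
Qed.

Lemma bounded_lipschitz_inv f m :
  0 < m -> (forall a b, m <= f a b) -> bounded_lipschitz f ->
  bounded_lipschitz (fun a b => / f a b).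
Proof.
  intros hm hf [L [hL [hb hl]]].
  assert (hi : forall a b, 0 < / f a b <= / m).
  { intros a b. specialize (hf a b). split; [apply Rinv_0_lt_compat; lra|].
    apply Rinv_le_contravar; lra. }
  assert (hm' : 0 < / m) by now apply Rinv_0_lt_compat.
  exists (/ m + / m * / m * L).
  assert (0 < / m * / m * L) by (repeat apply Rmult_lt_0_compat; lra).
  split; [lra|]. split.
  - intros a b. specialize (hi a b). rewrite Rabs_right; lra.
  - intros a b a' b'.
    assert (e : / f a b - / f a' b' = / f a b * / f a' b' * (f a' b' - f a b)).
    { assert (h1 := hf a b). assert (h2 := hf a' b'). field. split; lra. }
    assert (h1 := hi a b). assert (h2 := hi a' b').
    rewrite e, Rabs_mult, (Rabs_right (/ f a b * / f a' b')) by (apply Rle_ge; nra).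
    rewrite (Rabs_minus_sym (f a' b')).
    assert (q1 := Rabs_pos (a - a')). assert (q2 := Rabs_pos (b - b')).
    assert (/ f a b * / f a' b' <= / m * / m) by (apply Rmult_le_compat; lra).
    assert (/ f a b * / f a' b' * Rabs (f a b - f a' b')
      <= (/ m * / m) * (L * (Rabs (a - a') + Rabs (b - b')))).
    { apply Rmult_le_compat; auto; [nra|apply Rabs_pos]. }
    nra.
Qed.

Lemma bounded_lipschitz_opp f : bounded_lipschitz f -> bounded_lipschitz (fun a b => - f a b).
Proof.
  intros [L [hL [hb hl]]]. exists L. split; [exact hL|]. split.
  - intros a b. rewrite Rabs_Ropp. apply hb.
  - intros a b a' b'. replace (- f a b - - f a' b') with (- (f a b - f a' b')) by ring.
    rewrite Rabs_Ropp. apply hl.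
Qed.

(** Composed with this retraction onto [0, 1], the planar field becomes bounded and globally
    Lipschitz, and is unchanged on the closed unit square. *)
Definition clip (x : R) : R := Rmax 0 (Rmin 1 x).

Lemma clip_bounds x : 0 <= clip x <= 1.
Proof.
  unfold clip. split; [apply Rmax_l|]. apply Rmax_lub; [lra|apply Rmin_l].
Qed.

Lemma clip_id x : 0 <= x <= 1 -> clip x = x.
Proof. intros h. unfold clip. rewrite Rmin_right, Rmax_right; lra. Qed.

Lemma clip_le x : 0 <= x -> clip x <= x.
Proof. intros h. unfold clip. apply Rmax_lub; [lra|apply Rmin_r]. Qed.

Lemma clip_ge x : x <= 1 -> x <= clip x.
Proof. intros h. unfold clip. rewrite Rmin_right by lra. apply Rmax_r. Qed.

Lemma clip_lip x y : Rabs (clip x - clip y) <= Rabs (x - y).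
Proof.
  unfold clip, Rmax, Rmin.
  repeat destruct Rle_dec; apply Rabs_le;
    assert (q := Rle_abs (x - y)); assert (q' := Rle_abs (- (x - y)));
    rewrite Rabs_Ropp in q'; lra.
Qed.

Lemma bounded_lipschitz_clip1 : bounded_lipschitz (fun a _ => clip a).
Proof.
  exists 1. split; [lra|]. split.
  - intros a b. assert (q := clip_bounds a). rewrite Rabs_right; lra.
  - intros a b a' b'. assert (q := clip_lip a a'). assert (q1 := Rabs_pos (b - b')). lra.
Qed.

Lemma bounded_lipschitz_clip2 : bounded_lipschitz (fun _ b => clip b).
Proof.
  exists 1. split; [lra|]. split.
  - intros a b. assert (q := clip_bounds b). rewrite Rabs_right; lra.
  - intros a b a' b'. assert (q := clip_lip b b'). assert (q1 := Rabs_pos (a - a')). lra.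
Qed.

Ltac bounded_lipschitz :=
  lazymatch goal with
  | |- bounded_lipschitz (fun a b => @?f a b + @?g a b) =>
      apply (bounded_lipschitz_plus f g); bounded_lipschitz
  | |- bounded_lipschitz (fun a b => @?f a b - @?g a b) =>
      apply (bounded_lipschitz_plus f (fun a b => - g a b)); bounded_lipschitz
  | |- bounded_lipschitz (fun a b => @?f a b * @?g a b) =>
      apply (bounded_lipschitz_mult f g); bounded_lipschitz
  | |- bounded_lipschitz (fun a b => - @?f a b) =>
      apply (bounded_lipschitz_opp f); bounded_lipschitz
  | |- bounded_lipschitz (fun a b => clip a) => apply bounded_lipschitz_clip1
  | |- bounded_lipschitz (fun a b => clip b) => apply bounded_lipschitz_clip2
  | |- bounded_lipschitz (fun a b => ?k) => apply (bounded_lipschitz_const k)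
  end.

(** Up to the first zero [g t * exp (M * t)] cannot decrease, so no zero is reached. Applied to [v],
    [r], [1 - v] and [1 - r] it keeps orbits off the four sides of the square. *)
Lemma stays_positive (g dg : R -> R) (M : R) :
  (forall t, 0 <= t -> is_derive g t (dg t)) ->
  (forall t, 0 <= t -> 0 <= g t -> - M * g t <= dg t) ->
  0 < g 0 -> forall t, 0 <= t -> 0 < g t.
Proof.
  intros hd hM h0 t ht.
  destruct (Rlt_le_dec 0 (g t)) as [h|h]; [exact h|exfalso].
  destruct (first_zero g 0 t) as [t0 [k1 [k2 k3]]]; try lra.
  { intros u hu. eapply is_derive_continuous, hd; lra. }
  set (G := fun t => g t * exp (M * t)).
  assert (H : G 0 + 0 * (t0 - 0) <= G t0).
  { apply derive_ge with (fun t => (dg t + M * g t) * exp (M * t)); [lra| |]; intros u hu.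
    - assert (hdu := hd u (proj1 hu)). unfold G. auto_derive.
      + eexists; exact hdu.
      + replace (Derive (fun x => g x) u) with (dg u) by (symmetry; apply is_derive_unique, hdu).
        ring.
    - apply Rmult_le_pos; [|left; apply exp_pos].
      destruct (Req_dec u t0) as [e|e].
      + subst. specialize (hM t0). lra.
      + assert (0 < g u) by (apply k3; lra). specialize (hM u). lra. }
  unfold G in H. rewrite k2, Rmult_0_r, exp_0 in H. lra.
Qed.

(** * The planar field and its forward flow on the open unit square *)

Section System.

Variables s b : R.
Hypotheses (hs : 0 < s < 1 / 4) (hb : (1 - s) / 3 < b < 1 / 3).

Definition v_rhs (v r : R) : R := (1 - v ^ 2) * ((1 - s) * r - 3 * s * v).

Definition growth (v r : R) : R :=
  3 * b - 1 + s + 2 * b * (1 - s) * r * v - 3 * s * v ^ 2.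

Definition r_rhs (v r : R) : R := r * (1 - r ^ 2) * growth v r / (1 - b * r ^ 2).

(** Membership in the open square is built in, so that the field and its truncation agree along the
    orbit. Forward time is enough until a period is known. *)
Definition trajectory (v r : R -> R) : Prop :=
  forall t, 0 <= t -> 0 < v t < 1 /\ 0 < r t < 1 /\
    is_derive v t (v_rhs (v t) (r t)) /\ is_derive r t (r_rhs (v t) (r t)).

Lemma den_bound r : 0 <= r <= 1 -> 2 / 3 <= 1 - b * r ^ 2 <= 1.
Proof. intros h. assert (0 <= r ^ 2 <= 1) by nra. nra. Qed.

Lemma v_rhs_clip_lipschitz : bounded_lipschitz (fun v r => v_rhs (clip v) (clip r)).
Proof. unfold v_rhs. simpl pow. bounded_lipschitz. Qed.

Lemma r_rhs_clip_lipschitz : bounded_lipschitz (fun v r => r_rhs (clip v) (clip r)).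
Proof.
  unfold r_rhs, growth, Rdiv.
  apply (bounded_lipschitz_mult
    (fun v r => clip r * (1 - clip r ^ 2) *
       (3 * b + - (1) + s + 2 * b * (1 - s) * clip r * clip v - 3 * s * clip v ^ 2))
    (fun v r => / (1 - b * clip r ^ 2))).
  - simpl pow. bounded_lipschitz.
  - apply (bounded_lipschitz_inv _ (2 / 3)); [lra| |].
    + intros v r. apply den_bound, clip_bounds.
    + simpl pow. bounded_lipschitz.
Qed.

Lemma growth_bound v r : 0 <= v <= 1 -> 0 <= r <= 1 -> -1 <= growth v r <= 2.
Proof.
  intros hv hr. unfold growth.
  assert (0 <= r * v <= 1) by nra.
  assert (0 <= v ^ 2 <= 1) by nra.
  assert (0 <= b * (1 - s) <= 1/3) by nra.
  assert (0 <= b * (1 - s) * (r * v) <= 1/3) by nra.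
  assert (0 <= s * v ^ 2 <= 1/4) by nra. lra.
Qed.

(** Each bound vanishes linearly at one of the sides [v = 0], [v = 1], the form required by
    [stays_positive] with [M = 2]; [r_rhs_bounds] does the same for [r] with 6. *)
Lemma v_rhs_bounds v r : 0 <= v <= 1 -> 0 <= r <= 1 ->
  - 2 * v <= v_rhs v r <= 2 * (1 - v).
Proof.
  intros hv hr. unfold v_rhs.
  assert (0 <= v ^ 2 <= 1) by nra.
  assert (0 <= (1 - s) * r <= 1) by nra.
  assert (0 <= 3 * s * v <= v) by nra.
  split; [nra|].
  assert ((1 - v ^ 2) * ((1 - s) * r - 3 * s * v) <= (1 - v ^ 2) * 1) by (apply Rmult_le_compat_l; lra).
  nra.
Qed.

Lemma r_rhs_bounds v r : 0 <= v <= 1 -> 0 <= r <= 1 ->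
  - 6 * r <= r_rhs v r <= 6 * (1 - r).
Proof.
  intros hv hr. unfold r_rhs.
  assert (hd := den_bound r hr). assert (hg := growth_bound v r hv hr).
  assert (hr2 : 0 <= r ^ 2 <= 1) by nra.
  set (k := growth v r / (1 - b * r ^ 2)).
  assert (hk : - 3 <= k <= 3).
  { unfold k. split.
    - apply Rmult_le_reg_r with (1 - b * r ^ 2); [lra|].
      unfold Rdiv. rewrite Rmult_assoc, Rinv_l, Rmult_1_r by lra. lra.
    - apply Rmult_le_reg_r with (1 - b * r ^ 2); [lra|].
      unfold Rdiv. rewrite Rmult_assoc, Rinv_l, Rmult_1_r by lra. lra. }
  replace (r * (1 - r ^ 2) * growth v r / (1 - b * r ^ 2)) with (r * (1 - r ^ 2) * k)
    by (unfold k; field; lra).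
  assert (0 <= r * (1 - r ^ 2)) by (apply Rmult_le_pos; lra).
  assert (r * (1 - r ^ 2) <= r) by nra.
  assert (r * (1 - r ^ 2) <= 2 * (1 - r)).
  { replace (r * (1 - r^2)) with ((r * (1 + r)) * (1 - r)) by ring.
    apply Rmult_le_compat_r; [lra|]. nra. }
  nra.
Qed.

(** The truncated field has solutions for all [t >= 0]; they never reach the sides, so the
    truncation is invisible along them. *)
Lemma trajectory_exists v0 r0 : 0 < v0 < 1 -> 0 < r0 < 1 ->
  exists v r, trajectory v r /\ v 0 = v0 /\ r 0 = r0.
Proof.
  intros hv0 hr0.
  destruct v_rhs_clip_lipschitz as [L1 [hL1 l1]].
  destruct r_rhs_clip_lipschitz as [L2 [hL2 l2]].
  destruct (picard_lindelof _ _ (Rmax L1 L2) v0 r0 (Rlt_le_trans _ _ _ hL1 (Rmax_l _ _))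
    (lipschitz2_weaken _ _ _ (Rmax_l L1 L2) l1) (lipschitz2_weaken _ _ _ (Rmax_r L1 L2) l2))
    as [v [r [ev [er hd]]]].
  exists v, r. split; [|now split]. intros t ht.
  assert (p1 : 0 < v t).
  { apply (stays_positive v _ 2 (fun t ht => proj1 (hd t ht))); try lra.
    intros u hu h. assert (q := v_rhs_bounds _ _ (clip_bounds (v u)) (clip_bounds (r u))).
    assert (q' := clip_le _ h). lra. }
  assert (p2 : 0 < r t).
  { apply (stays_positive r _ 6 (fun t ht => proj2 (hd t ht))); try lra.
    intros u hu h. assert (q := r_rhs_bounds _ _ (clip_bounds (v u)) (clip_bounds (r u))).
    assert (q' := clip_le _ h). lra. }
  assert (comp : forall g dg : R -> R, (forall t, 0 <= t -> is_derive g t (dg t)) ->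
     forall t, 0 <= t -> is_derive (fun u => 1 - g u) t (- dg t)).
  { intros g dg hg u hu. replace (- dg u) with (0 - dg u) by ring.
    apply (is_derive_minus (fun _ => 1) g); [apply is_derive_constant|now apply hg]. }
  assert (p3 : 0 < 1 - v t).
  { apply (stays_positive _ _ 2 (comp _ _ (fun t ht => proj1 (hd t ht)))); try lra.
    intros u hu h. assert (q := v_rhs_bounds _ _ (clip_bounds (v u)) (clip_bounds (r u))).
    assert (q' := clip_ge (v u)). lra. }
  assert (p4 : 0 < 1 - r t).
  { apply (stays_positive _ _ 6 (comp _ _ (fun t ht => proj2 (hd t ht)))); try lra.
    intros u hu h. assert (q := r_rhs_bounds _ _ (clip_bounds (v u)) (clip_bounds (r u))).
    assert (q' := clip_ge (r u)). lra. }
  assert (q := hd t ht). rewrite !clip_id in q by lra.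
  split; [lra|]. split; [lra|exact q].
Qed.

Lemma trajectory_close : exists K, 0 < K /\ forall v r v' r' t,
  trajectory v r -> trajectory v' r' -> 0 <= t ->
  (v t - v' t) ^ 2 + (r t - r' t) ^ 2
    <= ((v 0 - v' 0) ^ 2 + (r 0 - r' 0) ^ 2) * exp (K * t).
Proof.
  destruct v_rhs_clip_lipschitz as [L1 [hL1 l1]].
  destruct r_rhs_clip_lipschitz as [L2 [hL2 l2]].
  assert (hm := Rmax_l L1 L2).
  exists (4 * Rmax L1 L2). split; [lra|].
  intros v r v' r' t h h' ht.
  apply (gronwall _ _ (Rmax L1 L2) ltac:(lra)
    (lipschitz2_weaken _ _ _ (Rmax_l L1 L2) l1) (lipschitz2_weaken _ _ _ (Rmax_r L1 L2) l2));
    [exact ht| |]; intros u hu.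
  - destruct (h u hu) as [q1 [q2 q]]. rewrite !clip_id by lra. exact q.
  - destruct (h' u hu) as [q1 [q2 q]]. rewrite !clip_id by lra. exact q.
Qed.

Lemma trajectory_shift v r a : 0 <= a -> trajectory v r ->
  trajectory (fun t => v (t + a)) (fun t => r (t + a)).
Proof.
  intros ha h t ht. destruct (h (t + a)) as [q1 [q2 [q3 q4]]]; [lra|].
  split; [exact q1|]. split; [exact q2|].
  assert (aux : forall (g : R -> R) (l : R), is_derive g (t + a) l -> is_derive (fun u => g (u + a)) t l).
  { intros g l hg. replace l with (1 * l) by ring.
    apply (is_derive_comp g (fun u => u + a)); [exact hg|].
    auto_derive; [exact I|ring]. }
  split; now apply aux.
Qed.

Lemma trajectory_lipschitz v r t u : trajectory v r -> 0 <= t <= u ->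
  Rabs (v u - v t) <= 6 * (u - t) /\ Rabs (r u - r t) <= 6 * (u - t).
Proof.
  intros h htu.
  assert (dv : forall w, t <= w <= u -> is_derive v w (v_rhs (v w) (r w)))
    by (intros w hw; apply (h w); lra).
  assert (dr : forall w, t <= w <= u -> is_derive r w (r_rhs (v w) (r w)))
    by (intros w hw; apply (h w); lra).
  assert (bv : forall w, t <= w <= u -> - 6 <= v_rhs (v w) (r w) <= 6).
  { intros w hw. destruct (h w ltac:(lra)) as [q1 [q2 _]].
    assert (q := v_rhs_bounds (v w) (r w) ltac:(lra) ltac:(lra)). lra. }
  assert (br : forall w, t <= w <= u -> - 6 <= r_rhs (v w) (r w) <= 6).
  { intros w hw. destruct (h w ltac:(lra)) as [q1 [q2 _]].
    assert (q := r_rhs_bounds (v w) (r w) ltac:(lra) ltac:(lra)). lra. }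
  assert (l1 := derive_ge v _ t u _ (proj2 htu) dv (fun w hw => proj1 (bv w hw))).
  assert (l2 := derive_le v _ t u _ (proj2 htu) dv (fun w hw => proj2 (bv w hw))).
  assert (l3 := derive_ge r _ t u _ (proj2 htu) dr (fun w hw => proj1 (br w hw))).
  assert (l4 := derive_le r _ t u _ (proj2 htu) dr (fun w hw => proj2 (br w hw))).
  split; apply Rabs_le; lra.
Qed.

Lemma trajectory_close_abs T : exists E, 1 <= E /\ forall v r v' r' t,
  trajectory v r -> trajectory v' r' -> v' 0 = v 0 -> 0 <= t <= T ->
  Rabs (v' t - v t) <= E * Rabs (r' 0 - r 0) /\ Rabs (r' t - r t) <= E * Rabs (r' 0 - r 0).
Proof.
  destruct (trajectory_close) as [K [hK hcl]].
  set (T0 := Rmax 0 T). assert (hT0 : 0 <= T0) by apply Rmax_l.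
  exists (exp (K * T0)).
  assert (hE : 1 <= exp (K * T0)).
  { assert (q := exp_ineq1_le (K * T0)). assert (0 <= K * T0) by (apply Rmult_le_pos; lra). lra. }
  split; [exact hE|]. intros v r v' r' t h h' e0 ht.
  assert (q := hcl v' r' v r t h' h (proj1 ht)).
  rewrite e0, Rminus_diag in q.
  assert (hEt : exp (K * t) <= exp (K * T0)).
  { destruct (Req_dec (K * t) (K * T0)) as [e|e]; [rewrite e; lra|].
    left. apply exp_increasing. assert (T <= T0) by apply Rmax_r.
    assert (K * t <= K * T0) by (apply Rmult_le_compat_l; lra). lra. }
  assert (hp := pow2_ge_0 (r' 0 - r 0)).
  assert (hf : (v' t - v t) ^ 2 + (r' t - r t) ^ 2 <= (exp (K * T0) * Rabs (r' 0 - r 0)) ^ 2).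
  { rewrite Rpow_mult_distr, pow2_abs.
    apply Rle_trans with (1 := q).
    replace (0 ^ 2 + (r' 0 - r 0) ^ 2) with ((r' 0 - r 0) ^ 2) by ring.
    rewrite Rmult_comm. apply Rmult_le_compat_r; [exact hp|].
    apply Rle_trans with (1 := hEt). simpl. nra. }
  assert (0 <= exp (K * T0) * Rabs (r' 0 - r 0)) by (apply Rmult_le_pos; [lra|apply Rabs_pos]).
  assert (p1 := pow2_ge_0 (v' t - v t)). assert (p2 := pow2_ge_0 (r' t - r t)).
  split; apply Rabs_le_of_sq; lra.
Qed.

Lemma trajectory_unique v r v' r' t : trajectory v r -> trajectory v' r' ->
  v' 0 = v 0 -> r' 0 = r 0 -> 0 <= t -> v' t = v t /\ r' t = r t.
Proof.
  intros h h' ev er ht.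
  destruct (trajectory_close_abs t) as [E [hE hcl]].
  destruct (hcl v r v' r' t h h' ev ltac:(lra)) as [q1 q2].
  rewrite er, Rminus_diag, Rabs_R0, Rmult_0_r in q1, q2.
  assert (p1 := Rabs_pos (v' t - v t)). assert (p2 := Rabs_pos (r' t - r t)).
  split; apply Rminus_diag_uniq; apply NNPP; intros n; apply Rabs_pos_lt in n; lra.
Qed.

End System.

(** * The equilibrium is a repeller *)

Section Equilibrium.

Variables s b vs rs : R.
Hypotheses (hs : 0 < s < 1 / 4) (hb : (1 - s) / 3 < b < 1 / 3).
Hypotheses (hvs : 0 < vs < 1) (hrs : 0 < rs < 1).
Hypotheses (evs : 3 * s * (1 - 2 * b) * vs ^ 2 = 3 * b - 1 + s)
  (ers : (1 - s) * rs = 3 * s * vs).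

(** The second summand contains the factor of [v']: it vanishes on the nullcline of [v] and is what
    the term [b * ln (1 - v ^ 2)] of [Zfun] cancels. The first has a sign on each side of the
    section. *)
Lemma growth_split v r :
  growth s b v r = 3 * s * (1 - 2 * b) * (vs ^ 2 - v ^ 2)
    + 2 * b * v * ((1 - s) * r - 3 * s * v).
Proof. rewrite Rmult_minus_distr_l, evs. unfold growth. ring. Qed.

(* Difference quotients of the vector field based at (vs, rs); at (vs, rs) they are
   the entries of the Jacobian. *)
Definition j11 (v r : R) : R := (1 - v * v) * (- (3 * s)).
Definition j12 (v r : R) : R := (1 - v * v) * (1 - s).
Definition j21 (v r : R) : R :=
  r * (1 - r * r) * (2 * b * (1 - s) * rs - 3 * s * (v + vs)) * / (1 - b * (r * r)).
Definition j22 (v r : R) : R :=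
  r * (1 - r * r) * (2 * b * (1 - s) * v) * / (1 - b * (r * r)).

(** An exact identity instead of a Taylor expansion: the nonlinearity sits in the coefficients,
    which [jacobian_lipschitz] compares with their values at the equilibrium. *)
Lemma v_rhs_hadamard v r :
  v_rhs s v r = j11 v r * (v - vs) + j12 v r * (r - rs).
Proof.
  unfold v_rhs, j11, j12.
  replace ((1 - s) * r) with ((1 - s) * (r - rs) + 3 * s * vs) by (rewrite <- ers; ring). ring.
Qed.

Lemma r_rhs_hadamard v r : 0 <= r <= 1 ->
  r_rhs s b v r = j21 v r * (v - vs) + j22 v r * (r - rs).
Proof.
  intros hr. assert (hd := den_bound s b hs hb r hr). unfold r_rhs, j21, j22.
  replace (growth s b v r) with ((2 * b * (1 - s) * rs - 3 * s * (v + vs)) * (v - vs)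
     + 2 * b * (1 - s) * v * (r - rs)).
  - field. simpl in hd |- *. lra.
  - rewrite growth_split.
    replace (2 * b * (1 - s) * rs) with (2 * b * (3 * s * vs)) by (rewrite <- ers; ring).
    replace (2 * b * (1 - s) * v * (r - rs)) with (2 * b * v * ((1 - s) * r - 3 * s * vs))
      by (rewrite <- ers; ring).
    ring.
Qed.

Lemma jacobian_lipschitz : exists L, 0 < L /\ forall v r, 0 <= v <= 1 -> 0 <= r <= 1 ->
  Rabs (j11 v r - j11 vs rs) <= L * (Rabs (v - vs) + Rabs (r - rs)) /\
  Rabs (j12 v r - j12 vs rs) <= L * (Rabs (v - vs) + Rabs (r - rs)) /\
  Rabs (j21 v r - j21 vs rs) <= L * (Rabs (v - vs) + Rabs (r - rs)) /\
  Rabs (j22 v r - j22 vs rs) <= L * (Rabs (v - vs) + Rabs (r - rs)).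
Proof.
  assert (hi : bounded_lipschitz (fun v r => / (1 - b * (clip r * clip r)))).
  { apply (bounded_lipschitz_inv _ (2 / 3)); [lra| |bounded_lipschitz].
    intros v r. assert (q := den_bound s b hs hb (clip r) (clip_bounds r)). simpl in q. lra. }
  assert (b11 : bounded_lipschitz (fun v r => j11 (clip v) (clip r)))
    by (unfold j11; bounded_lipschitz).
  assert (b12 : bounded_lipschitz (fun v r => j12 (clip v) (clip r)))
    by (unfold j12; bounded_lipschitz).
  assert (b21 : bounded_lipschitz (fun v r => j21 (clip v) (clip r))).
  { unfold j21. apply (bounded_lipschitz_mult (fun v r => clip r * (1 - clip r * clip r)
      * (2 * b * (1 - s) * rs - 3 * s * (clip v + vs)))); [bounded_lipschitz|exact hi]. }
  assert (b22 : bounded_lipschitz (fun v r => j22 (clip v) (clip r))).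
  { unfold j22. apply (bounded_lipschitz_mult (fun v r => clip r * (1 - clip r * clip r)
      * (2 * b * (1 - s) * clip v))); [bounded_lipschitz|exact hi]. }
  destruct b11 as [L1 [k1 [_ l1]]], b12 as [L2 [k2 [_ l2]]],
    b21 as [L3 [k3 [_ l3]]], b22 as [L4 [k4 [_ l4]]].
  exists (L1 + L2 + L3 + L4). split; [lra|]. intros v r hv hr.
  specialize (l1 v r vs rs). specialize (l2 v r vs rs).
  specialize (l3 v r vs rs). specialize (l4 v r vs rs).
  rewrite !clip_id in l1, l2, l3, l4 by lra.
  assert (q1 := Rabs_pos (v - vs)). assert (q2 := Rabs_pos (r - rs)).
  repeat split; nra.
Qed.

(** Excludes a saddle, so that the trace decides stability; the determinant also serves as a
    coefficient of the Lyapunov form. *)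
Lemma jacobian_det :
  0 < j11 vs rs * j22 vs rs - j12 vs rs * j21 vs rs.
Proof.
  assert (hd := den_bound s b hs hb rs ltac:(lra)).
  set (h := rs * (1 - rs * rs) * / (1 - b * (rs * rs))).
  assert (hh : 0 < h).
  { unfold h. simpl in hd. apply Rmult_lt_0_compat; [nra|]. apply Rinv_0_lt_compat. lra. }
  replace (j11 vs rs * j22 vs rs - j12 vs rs * j21 vs rs)
    with ((1 - vs * vs) * h * (1 - s) * (6 * s * vs * (1 - 2 * b))).
  - assert (0 < 1 - vs * vs) by nra. clearbody h.
    repeat apply Rmult_lt_0_compat; lra.
  - unfold j11, j12, j21, j22.
    replace (2 * b * (1 - s) * rs) with (2 * b * (3 * s * vs)) by (rewrite <- ers; ring).
    unfold h. ring.
Qed.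

(** Positivity of the trace of the Jacobian, divided by [3 * s] and multiplied by
    [1 - b * rs ^ 2]. *)
Hypothesis htr : (1 - vs ^ 2) * (1 - b * rs ^ 2) < 2 * b * vs ^ 2 * (1 - rs ^ 2).

Lemma jacobian_trace : 0 < j11 vs rs + j22 vs rs.
Proof.
  assert (hd := den_bound s b hs hb rs ltac:(lra)).
  apply Rmult_lt_reg_r with (1 - b * (rs * rs)); [simpl in hd; lra|].
  unfold j11, j22.
  replace (rs * (1 - rs * rs) * (2 * b * (1 - s) * vs)) with
    (6 * s * b * vs ^ 2 * (1 - rs ^ 2))
    by (replace (6 * s * b * vs ^ 2) with (2 * b * vs * (3 * s * vs)) by ring; rewrite <- ers; ring).
  rewrite Rmult_plus_distr_r, (Rmult_assoc _ (/ _)), Rinv_l, Rmult_1_r by (simpl in hd; lra).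
  nra.
Qed.

(* The form [d |xi|^2 + |adj(J) xi|^2], with [d = det J]: its derivative along
   [xi' = J xi] is [2 d (tr J) |xi|^2]. *)
Lemma quadratic_lyapunov (a11 a12 a21 a22 : R) :
  let d := a11 * a22 - a12 * a21 in
  let X p q := d * p + a22 * (a22 * p - a12 * q) - a21 * (a11 * q - a21 * p) in
  let Y p q := d * q - a12 * (a22 * p - a12 * q) + a11 * (a11 * q - a21 * p) in
  0 < d -> 0 < a11 + a22 -> forall L, 0 < L ->
  exists e, 0 < e /\ forall p q b11 b12 b21 b22, Rabs p <= e -> Rabs q <= e ->
    Rabs (b11 - a11) <= L * (Rabs p + Rabs q) -> Rabs (b12 - a12) <= L * (Rabs p + Rabs q) ->
    Rabs (b21 - a21) <= L * (Rabs p + Rabs q) -> Rabs (b22 - a22) <= L * (Rabs p + Rabs q) ->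
    0 <= 2 * (X p q * (b11 * p + b12 * q) + Y p q * (b21 * p + b22 * q)).
Proof.
  intros d X Y hd ht L hL.
  set (t := a11 + a22) in *.
  set (C := 1 + Rabs (d + a22 * a22 + a21 * a21) + Rabs (a22 * a12 + a21 * a11)
          + Rabs (d + a12 * a12 + a11 * a11)).
  assert (hC : 1 <= C).
  { unfold C. assert (q1 := Rabs_pos (d + a22 * a22 + a21 * a21)).
    assert (q2 := Rabs_pos (a22 * a12 + a21 * a11)).
    assert (q3 := Rabs_pos (d + a12 * a12 + a11 * a11)). lra. }
  assert (hCL : 0 < C * L) by (apply Rmult_lt_0_compat; lra).
  assert (hdt : 0 < d * t) by (apply Rmult_lt_0_compat; lra).
  (* With [n <= 2 * e] and [n^2 <= 2 * (p^2 + q^2)], each of the two error terms is at most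
     [4 * C * L * e * (p^2 + q^2)], half of the main term [d * t * (p^2 + q^2)]. *)
  exists (d * t / (8 * (C * L))). split; [apply Rdiv_lt_0_compat; lra|].
  set (e := d * t / (8 * (C * L))).
  assert (he : 8 * (C * L) * e = d * t) by (unfold e; field; split; lra).
  clearbody e.
  intros p q b11 b12 b21 b22 hp hq h11 h12 h21 h22.
  set (n := Rabs p + Rabs q) in *.
  assert (hn : 0 <= n) by (unfold n; assert (k1 := Rabs_pos p); assert (k2 := Rabs_pos q); lra).
  assert (lin : forall u c1 c2, Rabs c1 <= u -> Rabs c2 <= u ->
    Rabs (c1 * p + c2 * q) <= u * n).
  { intros u c1 c2 g1 g2. apply Rle_trans with (1 := Rabs_triang _ _).
    rewrite !Rabs_mult. unfold n.
    assert (k1 := Rabs_pos p). assert (k2 := Rabs_pos q). nra. }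
  assert (hX : Rabs (X p q) <= C * n).
  { replace (X p q) with ((d + a22 * a22 + a21 * a21) * p + (- (a22 * a12 + a21 * a11)) * q)
      by (unfold X; ring).
    apply (lin C); rewrite ?Rabs_Ropp; unfold C;
    assert (q1 := Rabs_pos (d + a22 * a22 + a21 * a21));
    assert (q2 := Rabs_pos (a22 * a12 + a21 * a11));
    assert (q3 := Rabs_pos (d + a12 * a12 + a11 * a11)); lra. }
  assert (hY : Rabs (Y p q) <= C * n).
  { replace (Y p q) with ((- (a22 * a12 + a21 * a11)) * p + (d + a12 * a12 + a11 * a11) * q)
      by (unfold Y; ring).
    apply (lin C); rewrite ?Rabs_Ropp; unfold C;
    assert (q1 := Rabs_pos (d + a22 * a22 + a21 * a21));
    assert (q2 := Rabs_pos (a22 * a12 + a21 * a11));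
    assert (q3 := Rabs_pos (d + a12 * a12 + a11 * a11)); lra. }
  assert (g1 := lin _ _ _ h11 h12).
  assert (g2 := lin _ _ _ h21 h22).
  set (E1 := (b11 - a11) * p + (b12 - a12) * q) in *.
  set (E2 := (b21 - a21) * p + (b22 - a22) * q) in *.
  replace (2 * (X p q * (b11 * p + b12 * q) + Y p q * (b21 * p + b22 * q)))
    with (2 * (d * t * (p ^ 2 + q ^ 2) + (X p q * E1 + Y p q * E2)))
    by (unfold X, Y, E1, E2, d, t; ring).
  assert (k1 : Rabs (X p q * E1) <= C * n * (L * n * n)).
  { rewrite Rabs_mult. apply Rmult_le_compat; auto; apply Rabs_pos. }
  assert (k2 : Rabs (Y p q * E2) <= C * n * (L * n * n)).
  { rewrite Rabs_mult. apply Rmult_le_compat; auto; apply Rabs_pos. }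
  apply Rabs_le_between in k1. apply Rabs_le_between in k2.
  assert (k3 : C * n * (L * n * n) <= (C * L) * (2 * e) * (2 * (p ^ 2 + q ^ 2))).
  { replace (C * n * (L * n * n)) with ((C * L) * (n * (n * n))) by ring.
    rewrite (Rmult_assoc (C * L)). apply Rmult_le_compat_l; [lra|].
    apply Rmult_le_compat; [lra|nra|unfold n; lra|].
    rewrite <- (pow2_abs p), <- (pow2_abs q). unfold n.
    assert (0 <= (Rabs p - Rabs q) ^ 2) by apply pow2_ge_0. nra. }
  assert (0 <= p ^ 2 + q ^ 2) by (assert (k4 := pow2_ge_0 p); assert (k5 := pow2_ge_0 q); lra).
  nra.
Qed.

(** Superlevel sets of [Q] at small levels are forward invariant. This keeps an orbit off the
    equilibrium, and through [Q 0 q = k * q ^ 2] it compares successive hits of the section. *)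
Lemma equilibrium_repels : exists (Q : R -> R -> R) (m C k q0 : R),
  0 < m /\ 0 < C /\ 0 < k /\ 0 < q0 /\
  (forall p q, m * (p ^ 2 + q ^ 2) <= Q p q <= C * (p ^ 2 + q ^ 2)) /\
  (forall q, Q 0 q = k * q ^ 2) /\
  (forall v r t q, trajectory s b v r -> 0 <= t -> q <= q0 ->
     q <= Q (v 0 - vs) (r 0 - rs) -> q <= Q (v t - vs) (r t - rs)).
Proof.
  assert (hd := jacobian_det). assert (ht := jacobian_trace).
  destruct jacobian_lipschitz as [L [hL hJ]].
  set (a11 := j11 vs rs) in *. set (a12 := j12 vs rs) in *.
  set (a21 := j21 vs rs) in *. set (a22 := j22 vs rs) in *.
  destruct (quadratic_lyapunov a11 a12 a21 a22 hd ht L hL) as [e [he hlyap]].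
  set (d := a11 * a22 - a12 * a21) in *.
  assert (sq := pow2_ge_0).
  exists (fun p q => d * (p ^ 2 + q ^ 2) + (a22 * p - a12 * q) ^ 2 + (a11 * q - a21 * p) ^ 2).
  (* At a level at most [d * e ^ 2] the summand [d * (p ^ 2 + q ^ 2)] alone confines the point to
     radius [e], where the derivative of [Q] has been controlled. *)
  exists d, (d + 2 * (a22 ^ 2 + a12 ^ 2 + a11 ^ 2 + a21 ^ 2)), (d + a12 ^ 2 + a11 ^ 2), (d * e ^ 2).
  assert (s1 := sq a11). assert (s2 := sq a12). assert (s3 := sq a21). assert (s4 := sq a22).
  assert (he2 : 0 < e ^ 2) by (simpl; nra).
  split; [exact hd|]. split; [lra|]. split; [lra|].
  split; [now apply Rmult_lt_0_compat|].
  split; [|split].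
  - intros p q.
    assert (h1 := sq (a22 * p - a12 * q)). assert (h2 := sq (a11 * q - a21 * p)).
    split; [lra|].
    assert (h3 := sq (a22 * p + a12 * q)). assert (h4 := sq (a11 * q + a21 * p)).
    assert (h5 := sq p). assert (h6 := sq q).
    assert (0 <= a22 ^ 2 * q ^ 2) by (apply Rmult_le_pos; auto).
    assert (0 <= a12 ^ 2 * p ^ 2) by (apply Rmult_le_pos; auto).
    assert (0 <= a11 ^ 2 * p ^ 2) by (apply Rmult_le_pos; auto).
    assert (0 <= a21 ^ 2 * q ^ 2) by (apply Rmult_le_pos; auto).
    lra.
  - intros q. ring.
  - intros v r t q htr' ht0 hq h0.
    set (X := fun p q => d * p + a22 * (a22 * p - a12 * q) - a21 * (a11 * q - a21 * p)) in *.
    set (Y := fun p q => d * q - a12 * (a22 * p - a12 * q) + a11 * (a11 * q - a21 * p)) in *.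
    apply (barrier (fun t => d * ((v t - vs) ^ 2 + (r t - rs) ^ 2)
        + (a22 * (v t - vs) - a12 * (r t - rs)) ^ 2
        + (a11 * (r t - rs) - a21 * (v t - vs)) ^ 2)
      (fun t => 2 * (X (v t - vs) (r t - rs) * v_rhs s (v t) (r t)
              + Y (v t - vs) (r t - rs) * r_rhs s b (v t) (r t))) q 0 t ht0); [| |exact h0].
    + intros u hu. destruct (htr' u (proj1 hu)) as [_ [_ [dv dr]]].
      auto_derive.
      * repeat split; eexists; eassumption.
      * replace (Derive (fun x => v x) u) with (v_rhs s (v u) (r u)) by (symmetry; apply is_derive_unique, dv).
        replace (Derive (fun x => r x) u) with (r_rhs s b (v u) (r u)) by (symmetry; apply is_derive_unique, dr).
        unfold X, Y. ring.
    + intros u hu hqu. destruct (htr' u (proj1 hu)) as [hv [hr _]].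
      rewrite v_rhs_hadamard, r_rhs_hadamard by lra.
      destruct (hJ (v u) (r u)) as [l1 [l2 [l3 l4]]]; try lra.
      set (p := v u - vs) in *. set (w := r u - rs) in *.
      assert (h1 := sq (a22 * p - a12 * w)). assert (h2 := sq (a11 * w - a21 * p)).
      assert (h5 := sq p). assert (h6 := sq w).
      assert (hn : p ^ 2 + w ^ 2 <= e ^ 2).
      { apply Rmult_le_reg_l with d; [exact hd|]. lra. }
      apply hlyap; auto.
      * apply Rabs_le_of_sq; lra.
      * apply Rabs_le_of_sq; lra.
Qed.

End Equilibrium.

(** * Return to the section *)

Lemma no_linear_growth (g dg : R -> R) (a m B : R) :
  0 < m ->
  (forall t, a <= t -> is_derive g t (dg t)) ->
  (forall t, a <= t -> m <= dg t) ->
  (forall t, a <= t -> g t <= B) -> False.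
Proof.
  intros hm hd hg hB.
  assert (h0 := hB a (Rle_refl a)).
  assert (hT : 0 <= (B - g a + 1) / m) by (apply Rdiv_le_0_compat; lra).
  assert (H := derive_ge g dg a (a + (B - g a + 1) / m) m ltac:(lra)
    (fun t ht => hd t (proj1 ht)) (fun t ht => hg t (proj1 ht))).
  replace (m * (a + (B - g a + 1) / m - a)) with (B - g a + 1) in H by (field; lra).
  specialize (hB (a + (B - g a + 1) / m)). lra.
Qed.

Lemma no_linear_decay (g dg : R -> R) (a m B : R) :
  0 < m ->
  (forall t, a <= t -> is_derive g t (dg t)) ->
  (forall t, a <= t -> dg t <= - m) ->
  (forall t, a <= t -> B <= g t) -> False.
Proof.
  intros hm hd hg hB.
  apply (no_linear_growth (fun t => - g t) (fun t => - dg t) a m (- B) hm).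
  - intros t ht. apply (is_derive_opp g t (dg t)), hd, ht.
  - intros t ht. specialize (hg t ht). lra.
  - intros t ht. specialize (hB t ht). lra.
Qed.

Lemma ln_le_0 x : 0 < x <= 1 -> ln x <= 0.
Proof. intros h. rewrite <- ln_1. apply ln_le; lra. Qed.

(** * The function Z, and return from the right side of the section *)

Section HalfTurns.

Variables s b vs rs : R.
Hypotheses (hs : 0 < s < 1 / 4) (hb : (1 - s) / 3 < b < 1 / 3).
Hypothesis hb2 : (5 - 2 * s) * (b + 1) < 6.
Hypotheses (hvs : 0 < vs < 1) (hrs : 0 < rs < 1).
Hypotheses (evs : 3 * s * (1 - 2 * b) * vs ^ 2 = 3 * b - 1 + s)
  (ers : (1 - s) * rs = 3 * s * vs).

(** The terms in [r] form a primitive of [(1 - b * r^2) / (r * (1 - r^2))], so along an orbit they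
    contribute exactly [growth]; the term in [v] removes the mixed summand of [growth_split]. *)
Definition Zfun (v r : R) : R :=
  ln r - (1 - b) / 2 * ln (1 - r ^ 2) + b * ln (1 - v ^ 2).

Lemma Zfun_derive v r t : trajectory s b v r -> 0 <= t ->
  is_derive (fun u => Zfun (v u) (r u)) t (3 * s * (1 - 2 * b) * (vs ^ 2 - v t ^ 2)).
Proof.
  intros h ht. destruct (h t ht) as [hv [hr [dv dr]]].
  assert (hd := den_bound s b hs hb (r t) ltac:(lra)).
  assert (0 < 1 - v t ^ 2) by nra. assert (0 < 1 - r t ^ 2) by nra.
  unfold Zfun. auto_derive.
  - repeat split; try (eexists; eassumption); lra.
  - replace (Derive (fun x => v x) t) with (v_rhs s (v t) (r t)) by (symmetry; apply is_derive_unique, dv).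
    replace (Derive (fun x => r x) t) with (r_rhs s b (v t) (r t)) by (symmetry; apply is_derive_unique, dr).
    unfold r_rhs. rewrite (growth_split s b vs evs). unfold v_rhs.
    field. repeat split; simpl in *; lra.
Qed.

Lemma Zfun_ge v r : 0 < v < 1 -> 0 < r < 1 -> ln r + b * ln (1 - v ^ 2) <= Zfun v r.
Proof.
  intros hv hr. unfold Zfun.
  assert (ln (1 - r ^ 2) <= 0) by (apply ln_le_0; nra). nra.
Qed.

Lemma Zfun_le v r : 0 < v < 1 -> 0 < r < 1 -> Zfun v r <= - ((1 - b) / 2 * ln (1 - r ^ 2)).
Proof.
  intros hv hr. unfold Zfun.
  assert (ln r <= 0) by (apply ln_le_0; lra).
  assert (ln (1 - v ^ 2) <= 0) by (apply ln_le_0; nra). nra.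
Qed.

Lemma r_rhs_le v r m : 0 < r < 1 -> 0 <= m -> growth s b v r <= - m ->
  r_rhs s b v r <= - (r * (1 - r ^ 2) * m).
Proof.
  intros hr hm hg. unfold r_rhs.
  assert (hd := den_bound s b hs hb r ltac:(lra)).
  assert (hp : 0 < r * (1 - r ^ 2)) by (apply Rmult_lt_0_compat; nra).
  apply Rmult_le_reg_r with (1 - b * r ^ 2); [lra|].
  unfold Rdiv. rewrite Rmult_assoc, Rinv_l, Rmult_1_r by lra.
  assert (r * (1 - r ^ 2) * growth s b v r <= r * (1 - r ^ 2) * - m)
    by (apply Rmult_le_compat_l; lra).
  assert (0 <= r * (1 - r ^ 2) * m) by (apply Rmult_le_pos; lra). nra.
Qed.

(** The quantity [6 - (5 - 2 * s) * (b + 1)] is [- growth s b 1 1]: hypothesis [hb2] makes [growth]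
    negative at the corner [v = r = 1]. *)
Lemma margin_bounds : 0 < 6 - (5 - 2 * s) * (b + 1) < 1.
Proof.
  split; [lra|].
  assert (9 / 2 * (5 / 4) < (5 - 2 * s) * (b + 1)) by (apply Rmult_le_0_lt_compat; lra).
  lra.
Qed.

(** For fixed [v], [growth] is largest as [r * v] tends to 1, and across a strip of width a quarter
    of the margin the term [- 3 * s * v ^ 2] varies by at most half of it, as [s < 1 / 4]. The bound
    is uniform in [r]. *)
Lemma growth_near_one v r : 0 < r < 1 -> 1 - (6 - (5 - 2 * s) * (b + 1)) / 4 <= v < 1 ->
  growth s b v r <= - ((6 - (5 - 2 * s) * (b + 1)) / 2).
Proof.
  intros hr hv. set (m := 6 - (5 - 2 * s) * (b + 1)) in *. unfold growth.
  assert (hm : 0 < m < 1) by exact margin_bounds.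
  assert (0 < 2 * b * (1 - s)) by nra.
  assert (0 < m / 4) by lra. assert (hrv : r * v <= 1) by nra.
  assert (2 * b * (1 - s) * r * v <= 2 * b * (1 - s)).
  { rewrite (Rmult_assoc (2 * b * (1 - s))). rewrite <- (Rmult_1_r (2 * b * (1 - s))) at 2.
    apply Rmult_le_compat_l; lra. }
  assert (0 <= s * (1 - v) ^ 2) by (apply Rmult_le_pos; [lra|apply pow2_ge_0]).
  assert (6 * s * (1 - v) <= 2 * (m / 4)) by (apply Rmult_le_compat; unfold m in *; lra).
  replace (3 * b - 1 + s) with (3 * s - m - 2 * b * (1 - s)) by (unfold m; ring).
  nra.
Qed.

(** Exclusion of a closed square of half-width [eta] about the equilibrium, arranged as an
    implication for use when [v] is already near [vs]. *)
Definition avoids (eta : R) (v r : R -> R) : Prop :=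
  forall t, 0 <= t -> Rabs (v t - vs) <= eta -> eta < Rabs (r t - rs).

(** While the orbit is above the nullcline [(1 - s) * r = 3 * s * v], [v] increases; it must cross
    this line, cannot recross it, and then [v] decreases with nowhere to settle. *)
Lemma leaves_right v r eta : trajectory s b v r -> 0 < eta -> avoids eta v r ->
  v 0 = vs -> (forall t, 0 < t -> vs < v t) -> False.
Proof.
  intros h heta hav v0 hgt.
  assert (hge : forall t, 0 <= t -> vs <= v t).
  { intros t ht. destruct (Req_dec t 0) as [e|e]; [subst; lra|]. left. apply hgt. lra. }
  assert (hk : 0 < 3 * s * (1 - 2 * b)) by (apply Rmult_lt_0_compat; lra).
  assert (dv := fun t ht => proj1 (proj2 (proj2 (h t ht)))).
  assert (dr := fun t ht => proj2 (proj2 (proj2 (h t ht)))).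
  assert (hA : exists ta, 0 <= ta /\ (1 - s) * r ta <= 3 * s * v ta).
  { apply NNPP. intros hn.
    assert (hup : forall t, 0 <= t -> 3 * s * v t < (1 - s) * r t).
    { intros t ht. apply Rnot_le_lt. intros q. apply hn. now exists t. }
    assert (hr : forall t, 0 <= t -> rs < r t).
    { intros t ht. specialize (hup t ht). specialize (hge t ht). nra. }
    assert (hmono : forall t u, 0 <= t -> t <= u -> v t <= v u).
    { intros t u ht htu.
      assert (q := derive_ge v _ t u 0 htu (fun w hw => dv w (Rle_trans _ _ _ ht (proj1 hw)))).
      assert (v t + 0 * (u - t) <= v u); [|lra]. apply q. intros w hw.
      destruct (h w ltac:(lra)) as [qv _]. specialize (hup w ltac:(lra)).
      unfold v_rhs. apply Rmult_le_pos; nra. }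
    set (m := 6 - (5 - 2 * s) * (b + 1)).
    assert (hm : 0 < m < 1) by exact margin_bounds.
    set (v1 := 1 - m / 4).
    (* Either [v] enters the strip next to [v = 1], where [r] decreases at a definite rate although
       it must exceed [rs], or [v] stays below [v1], and Z decreases linearly although it is bounded
       below. *)
    destruct (classic (exists t1, 0 <= t1 /\ v1 <= v t1)) as [[t1 [ht1 hv1]]|hno].
    - assert (hg : forall t, t1 <= t -> r_rhs s b (v t) (r t) <= - (r t * (1 - r t ^ 2) * (m / 2))).
      { intros t ht. destruct (h t ltac:(lra)) as [qv [qr _]].
        apply r_rhs_le; [exact qr|lra|]. apply growth_near_one; [exact qr|].
        assert (q := hmono t1 t ht1 ht). fold m. fold v1. lra. }
      assert (hdec : forall t, t1 <= t -> r t <= r t1).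
      { intros t ht.
        assert (q := derive_le r _ t1 t 0 ht (fun w hw => dr w (Rle_trans _ _ _ ht1 (proj1 hw)))).
        assert (r t <= r t1 + 0 * (t - t1)); [|lra]. apply q. intros w hw.
        destruct (h w ltac:(lra)) as [qv [qr _]]. specialize (hg w (proj1 hw)).
        assert (0 <= r w * (1 - r w ^ 2)) by (apply Rmult_le_pos; nra). nra. }
      destruct (h t1 ht1) as [qv1 [qr1 _]].
      assert (h1r : 0 < 1 - r t1 ^ 2) by nra.
      apply (no_linear_decay r _ t1 (rs * (1 - r t1 ^ 2) * (m / 2)) 0
        ltac:(repeat apply Rmult_lt_0_compat; lra)
        (fun t ht => dr t (Rle_trans _ _ _ ht1 ht))).
      + intros t ht. specialize (hg t ht). destruct (h t ltac:(lra)) as [qv [qr _]].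
        assert (q1 := hr t ltac:(lra)). assert (q2 := hdec t ht).
        assert (rs * (1 - r t1 ^ 2) <= r t * (1 - r t ^ 2)) by (apply Rmult_le_compat; nra).
        nra.
      + intros t ht. destruct (h t ltac:(lra)) as [qv [qr _]]. lra.
    - assert (hlt : forall t, 0 <= t -> v t < v1).
      { intros t ht. apply Rnot_le_lt. intros q. apply hno. now exists t. }
      assert (hva := hgt 1 Rlt_0_1).
      assert (hd1 : 0 < v 1 ^ 2 - vs ^ 2) by nra.
      apply (no_linear_decay (fun t => Zfun (v t) (r t)) _ 1
        (3 * s * (1 - 2 * b) * (v 1 ^ 2 - vs ^ 2)) (ln rs + b * ln (1 - v1 ^ 2))
        ltac:(apply Rmult_lt_0_compat; lra)
        (fun t ht => Zfun_derive v r t h (Rle_trans _ _ _ Rle_0_1 ht))).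
      + intros t ht. assert (q := hmono 1 t ltac:(lra) ht).
        assert (v 1 ^ 2 <= v t ^ 2) by nra. nra.
      + intros t ht. destruct (h t ltac:(lra)) as [qv [qr _]].
        apply Rle_trans with (2 := Zfun_ge _ _ qv qr).
        specialize (hlt t ltac:(lra)). specialize (hr t ltac:(lra)).
        apply Rplus_le_compat; [apply ln_le; lra|].
        apply Rmult_le_compat_l; [lra|]. apply ln_le; [unfold v1; nra|].
        unfold v1 in *; nra. }
  destruct hA as [ta [hta hA]].
  (* On the nullcline with [v > vs] one has [v' = 0] and, by [growth_split], [r' < 0], so the line
     is crossed in one direction only. *)
  assert (hlow : forall t, ta <= t -> (1 - s) * r t <= 3 * s * v t).
  { intros t ht.
    cut (0 <= 3 * s * v t - (1 - s) * r t); [lra|].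
    apply (barrier_strict (fun t => 3 * s * v t - (1 - s) * r t)
      (fun t => 3 * s * v_rhs s (v t) (r t) - (1 - s) * r_rhs s b (v t) (r t)) ta t ht);
      [| |lra].
    - intros u hu. assert (d1 := dv u ltac:(lra)). assert (d2 := dr u ltac:(lra)).
      auto_derive; [repeat split; eexists; eassumption|].
      replace (Derive (fun x => v x) u) with (v_rhs s (v u) (r u)) by (symmetry; apply is_derive_unique, d1).
      replace (Derive (fun x => r x) u) with (r_rhs s b (v u) (r u)) by (symmetry; apply is_derive_unique, d2).
      ring.
    - intros u hu e. destruct (h u ltac:(lra)) as [qv [qr _]].
      destruct (Rle_lt_or_eq_dec _ _ (hge u ltac:(lra))) as [hgu|ee].
      + assert (ev : v_rhs s (v u) (r u) = 0) by (unfold v_rhs; replace ((1 - s) * r u) with (3 * s * v u) by lra; ring).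
        rewrite ev.
        assert (hg : growth s b (v u) (r u) <= - (3 * s * (1 - 2 * b) * (v u ^ 2 - vs ^ 2))).
        { rewrite (growth_split s b vs evs).
          replace ((1 - s) * r u - 3 * s * v u) with 0 by lra. lra. }
        assert (hsq : 0 < v u ^ 2 - vs ^ 2) by nra.
        assert (hp := Rmult_lt_0_compat _ _ hk hsq).
        assert (q := r_rhs_le _ _ _ qr (Rlt_le _ _ hp) hg).
        assert (0 < r u * (1 - r u ^ 2)) by (apply Rmult_lt_0_compat; nra).
        assert (q' := Rmult_lt_0_compat _ _ H hp). nra.
      (* On the nullcline [v = vs] means [r = rs], the equilibrium itself. *)
      + exfalso. assert (q := hav u ltac:(lra)).
        rewrite <- ee, Rminus_diag, Rabs_R0 in q. specialize (q ltac:(lra)).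
        assert (er : r u = rs) by (rewrite <- ee in e; nra).
        rewrite er, Rminus_diag, Rabs_R0 in q. lra. }
  assert (hdec : forall t u, ta <= t -> t <= u -> v u <= v t).
  { intros t u ht htu.
    assert (q := derive_le v _ t u 0 htu (fun w hw => dv w ltac:(lra))).
    assert (v u <= v t + 0 * (u - t)); [|lra]. apply q. intros w hw.
    destruct (h w ltac:(lra)) as [qv _]. specialize (hlow w ltac:(lra)).
    unfold v_rhs. assert (0 <= 1 - v w ^ 2) by nra. nra. }
  destruct (h ta hta) as [qva _].
  assert (hsa : 0 < 1 - v ta ^ 2) by nra.
  (* With [v >= vs] and [r <= rs - a], the decrease of [v] has a positive lower bound, impossible
     for all time. *)
  assert (hfin : forall t0 a, 0 < a -> ta <= t0 -> (forall t, t0 <= t -> r t <= rs - a) -> False).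
  { intros t0 a ha ht0 hra.
    apply (no_linear_decay v _ t0 ((1 - v ta ^ 2) * ((1 - s) * a)) 0
      ltac:(repeat apply Rmult_lt_0_compat; lra)
      (fun t ht => dv t (Rle_trans _ _ _ hta (Rle_trans _ _ _ ht0 ht)))).
    - intros t ht. destruct (h t ltac:(lra)) as [qv [qr _]].
      assert (q1 := hdec ta t ltac:(lra) ltac:(lra)).
      assert (q2 := hge t ltac:(lra)). specialize (hra t ht).
      unfold v_rhs.
      assert ((1 - s) * a <= 3 * s * v t - (1 - s) * r t) by nra.
      assert (1 - v ta ^ 2 <= 1 - v t ^ 2) by nra.
      assert ((1 - v ta ^ 2) * ((1 - s) * a) <= (1 - v t ^ 2) * (3 * s * v t - (1 - s) * r t)).
      { apply Rmult_le_compat; try lra. apply Rmult_le_pos; lra. }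
      lra.
    - intros t ht. destruct (h t ltac:(lra)) as [qv _]. lra. }
  destruct (classic (exists tc, ta <= tc /\ v tc <= vs + eta / 2)) as [[tc [htc hc]]|hno].
  - apply (hfin tc (eta)); auto. intros t ht.
    assert (q1 := hdec tc t htc ht). assert (q2 := hge t ltac:(lra)).
    assert (q3 := hav t ltac:(lra)). rewrite (Rabs_right (v t - vs)) in q3 by lra.
    specialize (q3 ltac:(lra)). assert (q4 := hlow t ltac:(lra)).
    assert (r t <= rs + eta / 2) by nra.
    destruct (Rle_lt_dec (r t) rs) as [k|k].
    + rewrite Rabs_left1 in q3 by lra. lra.
    + rewrite Rabs_right in q3 by lra. lra.
  - assert (hbig : forall t, ta <= t -> vs + eta / 2 < v t).
    { intros t ht. apply Rnot_le_lt. intros q. apply hno. now exists t. }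
    set (m := 3 * s * (1 - 2 * b) * ((vs + eta / 2) ^ 2 - vs ^ 2)).
    assert (hm : 0 < m) by (apply Rmult_lt_0_compat; nra).
    assert (hZd : forall t, ta <= t ->
      3 * s * (1 - 2 * b) * (vs ^ 2 - v t ^ 2) <= - m).
    { intros t ht. specialize (hbig t ht).
      assert ((vs + eta / 2) ^ 2 <= v t ^ 2) by (apply pow_incr; lra). unfold m; nra. }
    (* Since [v <= v ta], a value of Z below [B] forces [r < rs / 2]; Z stays below once there. *)
    set (B := ln (rs / 2) + b * ln (1 - v ta ^ 2)).
    assert (hZ : exists tb, ta <= tb /\ Zfun (v tb) (r tb) < B).
    { apply NNPP. intros hn.
      apply (no_linear_decay (fun t => Zfun (v t) (r t)) _ ta m B hm
        (fun t ht => Zfun_derive v r t h (Rle_trans _ _ _ hta ht)) hZd).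
      intros t ht. apply Rnot_lt_le. intros q. apply hn. now exists t. }
    destruct hZ as [tb [htb hB]].
    apply (hfin tb (rs / 2)); try lra. intros t ht.
    assert (q := derive_le (fun t => Zfun (v t) (r t)) _ tb t (- m) ht
      (fun u hu => Zfun_derive v r u h ltac:(lra)) (fun u hu => hZd u ltac:(lra))).
    cbv beta in q.
    destruct (h t ltac:(lra)) as [qv [qr _]].
    assert (q2 := Zfun_ge _ _ qv qr).
    assert (q3 := hdec ta t ltac:(lra) ltac:(lra)).
    assert (ln (1 - v ta ^ 2) <= ln (1 - v t ^ 2)) by (apply ln_le; nra).
    assert (hl : ln (r t) < ln (rs / 2)).
    { unfold B in hB. assert (0 <= m * (t - tb)) by (apply Rmult_le_pos; lra). nra. }
    apply ln_lt_inv in hl; lra.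
Qed.

End HalfTurns.

(** * The bound away from [r = 1], and return from the left side *)

Section LeftTurn.

Variables s b vs rs : R.
Hypotheses (hs : 0 < s < 1 / 4) (hb : (1 - s) / 3 < b < 1 / 3).
Hypotheses (hvs : 0 < vs < 1) (hrs : 0 < rs < 1).
Hypotheses (evs : 3 * s * (1 - 2 * b) * vs ^ 2 = 3 * b - 1 + s)
  (ers : (1 - s) * rs = 3 * s * vs).

(** A lower bound for [v'] where [v <= vs] and [r >= (1 + rs) / 2]: there [(1 - s) * r - 3 * s * v]
    is at least [(1 - s) * (r - rs)]. *)
Definition slope : R := (1 - vs ^ 2) * ((1 - s) * ((1 - rs) / 2)).

Definition r_cap : R := 1 - (1 - rs) / 2 * exp (- (6 / slope)).

Lemma slope_pos : 0 < slope.
Proof. unfold slope. repeat apply Rmult_lt_0_compat; try lra; nra. Qed.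

Lemma r_cap_lt_1 : r_cap < 1.
Proof.
  unfold r_cap. assert (q := exp_pos (- (6 / slope))).
  assert (0 < (1 - rs) / 2 * exp (- (6 / slope))) by (apply Rmult_lt_0_compat; lra). lra.
Qed.

(* Near [r = 1] one has [r' <= 6 (1 - r)] while [v' >= slope]; as [v] only has room
   for a bounded increase, [1 - r] cannot become too small. *)
Lemma r_le_cap v r t : trajectory s b v r -> 0 <= t ->
  (forall u, 0 <= u <= t -> v u <= vs) -> r 0 <= rs -> r t <= r_cap.
Proof.
  intros h ht hle h0. assert (hsl := slope_pos).
  set (k := 6 / slope). assert (hk : 0 < k) by (apply Rdiv_lt_0_compat; lra).
  assert (hks : k * slope = 6) by (unfold k; field; lra).
  assert (one_le : forall w, 0 <= w -> 1 <= exp (k * w)).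
  { intros w hw. assert (q := exp_ineq1_le (k * w)). assert (0 <= k * w) by (apply Rmult_le_pos; lra). lra. }
  (* Where this weighted distance to [r = 1] is small, its logarithmic derivative is at least
     [- 6 + k * slope], and [k] makes this zero. *)
  assert (H : (1 - rs) / 2 <= (1 - r t) * exp (k * v t)).
  { apply (barrier (fun t => (1 - r t) * exp (k * v t))
      (fun t => exp (k * v t) * (- r_rhs s b (v t) (r t) + (1 - r t) * (k * v_rhs s (v t) (r t))))
      _ 0 t ht).
    - intros u hu. destruct (h u (proj1 hu)) as [_ [_ [d1 d2]]].
      auto_derive; [repeat split; eexists; eassumption|].
      replace (Derive (fun x => v x) u) with (v_rhs s (v u) (r u)) by (symmetry; apply is_derive_unique, d1).
      replace (Derive (fun x => r x) u) with (r_rhs s b (v u) (r u)) by (symmetry; apply is_derive_unique, d2).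
      ring.
    - intros u hu hG. destruct (h u (proj1 hu)) as [qv [qr _]].
      assert (q1 := one_le (v u) ltac:(lra)).
      assert (q2 := r_rhs_bounds s b hs hb (v u) (r u) ltac:(lra) ltac:(lra)).
      assert (q3 := hle u hu).
      assert (q4 : 1 - r u <= (1 - rs) / 2) by nra.
      assert (q5 : slope <= v_rhs s (v u) (r u)).
      { unfold slope, v_rhs. apply Rmult_le_compat; [nra|nra|nra|].
        nra. }
      apply Rmult_le_pos; [lra|].
      assert (6 <= k * v_rhs s (v u) (r u)) by (rewrite <- hks; apply Rmult_le_compat_l; lra).
      assert ((1 - r u) * 6 <= (1 - r u) * (k * v_rhs s (v u) (r u))) by (apply Rmult_le_compat_l; lra).
      lra.
    - destruct (h 0 (Rle_refl 0)) as [qv [qr _]].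
      assert (q1 := one_le (v 0) ltac:(lra)). nra. }
  destruct (h t ht) as [qv [qr _]].
  unfold r_cap. fold k. rewrite exp_Ropp.
  assert (hm : exp (k * v t) <= exp k).
  { destruct (Req_dec (k * v t) k) as [e|e]; [rewrite e; lra|]. left. apply exp_increasing. nra. }
  assert (hp := exp_pos k).
  cut ((1 - rs) / 2 * / exp k <= 1 - r t); [lra|].
  apply Rmult_le_reg_r with (exp k); [exact hp|].
  rewrite Rmult_assoc, Rinv_l, Rmult_1_r by lra.
  apply Rle_trans with (1 := H). apply Rmult_le_compat_l; lra.
Qed.

Lemma r_rhs_pos v r : 0 < r < 1 -> 0 < growth s b v r -> 0 < r_rhs s b v r.
Proof.
  intros hr hg. unfold r_rhs.
  assert (hd := den_bound s b hs hb r ltac:(lra)).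
  apply Rdiv_lt_0_compat; [|lra].
  apply Rmult_lt_0_compat; [|exact hg]. apply Rmult_lt_0_compat; nra.
Qed.

(** The directions are reversed: [v] first decreases, crosses the nullcline once, then increases.
    The start below [rs] gives the cap on [r], which bounds Z from above. *)
Lemma leaves_left v r eta : trajectory s b v r -> 0 < eta -> avoids vs rs eta v r ->
  v 0 = vs -> r 0 <= rs -> (forall t, 0 < t -> v t < vs) -> False.
Proof.
  intros h heta hav v0 r0 hlt.
  assert (hle : forall t, 0 <= t -> v t <= vs).
  { intros t ht. destruct (Req_dec t 0) as [e|e]; [subst; lra|]. left. apply hlt. lra. }
  assert (hk : 0 < 3 * s * (1 - 2 * b)) by (apply Rmult_lt_0_compat; lra).
  assert (dv := fun t ht => proj1 (proj2 (proj2 (h t ht)))).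
  assert (dr := fun t ht => proj2 (proj2 (proj2 (h t ht)))).
  assert (hcap : forall t, 0 <= t -> r t <= r_cap).
  { intros t ht. apply (r_le_cap v r t h ht); [|exact r0]. intros u hu. apply hle; lra. }
  assert (hcap1 := r_cap_lt_1).
  assert (hcap0 : 0 < r_cap).
  { specialize (hcap 0 (Rle_refl 0)). destruct (h 0 (Rle_refl 0)) as [_ [qr _]]. lra. }
  assert (hZle : forall t, 0 <= t -> Zfun b (v t) (r t) <= - ((1 - b) / 2 * ln (1 - r_cap ^ 2))).
  { intros t ht. destruct (h t ht) as [qv [qr _]].
    apply Rle_trans with (1 := Zfun_le s b hs hb _ _ qv qr). specialize (hcap t ht).
    apply Ropp_le_contravar, Rmult_le_compat_l; [lra|]. apply ln_le; nra. }
  (* If [v] stays below a level smaller than [vs], Z grows linearly against its upper bound. This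
     excludes both a permanent descent and a later ascent stopping short of [vs]. *)
  assert (hZ : forall t0 a, 0 <= t0 -> a < vs -> (forall t, t0 <= t -> v t <= a) -> False).
  { intros t0 a ht0 ha hva.
    destruct (h t0 ht0) as [qv0 _].
    assert (ha0 : 0 < a) by (specialize (hva t0 (Rle_refl _)); lra).
    apply (no_linear_growth (fun t => Zfun b (v t) (r t)) _ t0
      (3 * s * (1 - 2 * b) * (vs ^ 2 - a ^ 2))
      (- ((1 - b) / 2 * ln (1 - r_cap ^ 2))) ltac:(apply Rmult_lt_0_compat; nra)
      (fun t ht => Zfun_derive s b vs hs hb evs v r t h (Rle_trans _ _ _ ht0 ht))
      ); [|exact (fun t ht => hZle t (Rle_trans _ _ _ ht0 ht))].
    intros t ht. destruct (h t ltac:(lra)) as [qv _]. specialize (hva t ht).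
    assert (v t ^ 2 <= a ^ 2) by (apply pow_incr; lra).
    apply Rmult_le_compat_l; lra. }
  assert (hA : exists ta, 0 <= ta /\ 3 * s * v ta <= (1 - s) * r ta).
  { apply NNPP. intros hn.
    assert (hup : forall t, 0 <= t -> (1 - s) * r t < 3 * s * v t).
    { intros t ht. apply Rnot_le_lt. intros q. apply hn. now exists t. }
    apply (hZ 1 (v 1) ltac:(lra) (hlt 1 Rlt_0_1)). intros t ht.
    assert (q := derive_le v _ 1 t 0 ht (fun w hw => dv w ltac:(lra))).
    assert (v t <= v 1 + 0 * (t - 1)); [|lra]. apply q. intros w hw.
    destruct (h w ltac:(lra)) as [qv _]. specialize (hup w ltac:(lra)).
    unfold v_rhs. assert (0 <= 1 - v w ^ 2) by nra. nra. }
  destruct hA as [ta [hta hA]].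
  assert (hupp : forall t, ta <= t -> 3 * s * v t <= (1 - s) * r t).
  { intros t ht.
    cut (0 <= (1 - s) * r t - 3 * s * v t); [lra|].
    apply (barrier_strict (fun t => (1 - s) * r t - 3 * s * v t)
      (fun t => (1 - s) * r_rhs s b (v t) (r t) - 3 * s * v_rhs s (v t) (r t)) ta t ht);
      [| |lra].
    - intros u hu. assert (d1 := dv u ltac:(lra)). assert (d2 := dr u ltac:(lra)).
      auto_derive; [repeat split; eexists; eassumption|].
      replace (Derive (fun x => v x) u) with (v_rhs s (v u) (r u)) by (symmetry; apply is_derive_unique, d1).
      replace (Derive (fun x => r x) u) with (r_rhs s b (v u) (r u)) by (symmetry; apply is_derive_unique, d2).
      ring.
    - intros u hu e. destruct (h u ltac:(lra)) as [qv [qr _]].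
      destruct (Rle_lt_or_eq_dec _ _ (hle u ltac:(lra))) as [hgu|ee].
      + assert (ev : v_rhs s (v u) (r u) = 0) by (unfold v_rhs; replace ((1 - s) * r u) with (3 * s * v u) by lra; ring).
        rewrite ev.
        assert (hsq : 0 < vs ^ 2 - v u ^ 2) by nra.
        assert (hp := Rmult_lt_0_compat _ _ hk hsq).
        assert (hg : 0 < growth s b (v u) (r u)).
        { rewrite (growth_split s b vs evs).
          replace ((1 - s) * r u - 3 * s * v u) with 0 by lra. lra. }
        assert (q := r_rhs_pos _ _ qr hg).
        assert (q' := Rmult_lt_0_compat (1 - s) _ ltac:(lra) q). lra.
      + exfalso. assert (q := hav u ltac:(lra)).
        rewrite ee, Rminus_diag, Rabs_R0 in q. specialize (q ltac:(lra)).
        assert (er : r u = rs) by (rewrite ee in e; nra).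
        rewrite er, Rminus_diag, Rabs_R0 in q. lra. }
  assert (hinc : forall t u, ta <= t -> t <= u -> v t <= v u).
  { intros t u ht htu.
    assert (q := derive_ge v _ t u 0 htu (fun w hw => dv w ltac:(lra))).
    assert (v t + 0 * (u - t) <= v u); [|lra]. apply q. intros w hw.
    destruct (h w ltac:(lra)) as [qv _]. specialize (hupp w ltac:(lra)).
    unfold v_rhs. apply Rmult_le_pos; nra. }
  (* Close to the section, [avoids] leaves only [r <= rs - eta] or [r >= rs + eta]; the nullcline
     inequality excludes the former, and then [v] rises at a definite rate. *)
  destruct (classic (exists tc, ta <= tc /\ vs - eta / 2 <= v tc)) as [[tc [htc hc]]|hno].
  - assert (hr : forall t, tc <= t -> rs + eta <= r t).
    { intros t ht.
      assert (q1 := hinc tc t htc ht). assert (q2 := hle t ltac:(lra)).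
      assert (q3 := hav t ltac:(lra)). rewrite (Rabs_left1 (v t - vs)) in q3 by lra.
      specialize (q3 ltac:(lra)). assert (q4 := hupp t ltac:(lra)).
      assert (rs - eta / 2 <= r t) by nra.
      destruct (Rle_lt_dec (r t) rs) as [k|k].
      + rewrite Rabs_left1 in q3 by lra. lra.
      + rewrite Rabs_right in q3 by lra. lra. }
    assert (hs2 : 0 < 1 - vs ^ 2) by nra.
    apply (no_linear_growth v _ tc ((1 - vs ^ 2) * ((1 - s) * eta)) 1
      ltac:(repeat apply Rmult_lt_0_compat; lra)
      (fun t ht => dv t (Rle_trans _ _ _ hta (Rle_trans _ _ _ htc ht)))).
    + intros t ht. destruct (h t ltac:(lra)) as [qv [qr _]].
      specialize (hr t ht). assert (q2 := hle t ltac:(lra)).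
      unfold v_rhs. apply Rmult_le_compat; [lra|nra|nra|nra].
    + intros t ht. destruct (h t ltac:(lra)) as [qv _]. lra.
  - apply (hZ ta (vs - eta / 2) hta ltac:(lra)). intros t ht.
    apply Rnot_lt_le. intros q. apply hno. exists t. lra.
Qed.

End LeftTurn.

(** * The return map *)

Section ReturnMap.

Variables s b vs rs : R.
Hypotheses (hs : 0 < s < 1 / 4) (hb : (1 - s) / 3 < b < 1 / 3).
Hypothesis hb2 : (5 - 2 * s) * (b + 1) < 6.
Hypotheses (hvs : 0 < vs < 1) (hrs : 0 < rs < 1).
Hypotheses (evs : 3 * s * (1 - 2 * b) * vs ^ 2 = 3 * b - 1 + s)
  (ers : (1 - s) * rs = 3 * s * vs).
Hypothesis htr : (1 - vs ^ 2) * (1 - b * rs ^ 2) < 2 * b * vs ^ 2 * (1 - rs ^ 2).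

Lemma trajectory_avoids v r : trajectory s b v r -> v 0 <> vs \/ r 0 <> rs ->
  exists eta, 0 < eta /\ avoids vs rs eta v r.
Proof.
  intros h h0.
  destruct (equilibrium_repels s b vs rs hs hb hvs hrs evs ers htr)
    as [Q [m [C [k [q0 [hm [hC [hk [hq0 [hQ [_ hinv]]]]]]]]]]].
  assert (hpos : 0 < Q (v 0 - vs) (r 0 - rs)).
  { assert (q := proj1 (hQ (v 0 - vs) (r 0 - rs))).
    assert (0 < (v 0 - vs) ^ 2 + (r 0 - rs) ^ 2).
    { destruct h0 as [n|n].
      - assert (0 < (v 0 - vs) ^ 2) by (apply pow2_gt_0; lra).
        assert (q' := pow2_ge_0 (r 0 - rs)). lra.
      - assert (0 < (r 0 - rs) ^ 2) by (apply pow2_gt_0; lra).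
        assert (q' := pow2_ge_0 (v 0 - vs)). lra. }
    assert (q' := Rmult_lt_0_compat _ _ hm H). lra. }
  set (q := Rmin q0 (Q (v 0 - vs) (r 0 - rs))).
  assert (hq : 0 < q) by (apply Rmin_pos; lra).
  assert (hq1 : q <= q0) by apply Rmin_l.
  assert (hq2 : q <= Q (v 0 - vs) (r 0 - rs)) by apply Rmin_r.
  (* Inside the square of half-width [eta <= 1] the form is at most
     [2 * C * eta ^ 2 <= 2 * C * eta <= q / 2], below the invariant level [q]. *)
  assert (he1 := Rmin_l 1 (q / (4 * C))). assert (he2 := Rmin_r 1 (q / (4 * C))).
  set (eta := Rmin 1 (q / (4 * C))) in *.
  assert (heta : 0 < eta) by (apply Rmin_pos; [lra|apply Rdiv_lt_0_compat; lra]).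
  assert (hC4 : 4 * C * eta <= q).
  { apply (Rmult_le_compat_l (4 * C)) in he2; [|lra].
    replace (4 * C * (q / (4 * C))) with q in he2 by (field; lra). exact he2. }
  exists eta. split; [exact heta|]. intros t ht hv.
  apply Rnot_le_lt. intros hr.
  assert (hh := hinv v r t q h ht hq1 hq2).
  assert (hc := proj2 (hQ (v t - vs) (r t - rs))).
  rewrite <- (pow2_abs (v t - vs)), <- (pow2_abs (r t - rs)) in hc.
  assert (Rabs (v t - vs) ^ 2 <= eta ^ 2) by (apply pow_incr; split; [apply Rabs_pos|exact hv]).
  assert (Rabs (r t - rs) ^ 2 <= eta ^ 2) by (apply pow_incr; split; [apply Rabs_pos|exact hr]).
  assert (eta ^ 2 <= eta) by (simpl; nra).
  assert (C * (Rabs (v t - vs) ^ 2 + Rabs (r t - rs) ^ 2) <= C * (2 * eta))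
    by (apply Rmult_le_compat_l; lra).
  lra.
Qed.

(** The sign [sg] is 1 for excursions to the right and -1 for those to the left, so both share the
    same lemmas. *)
Definition half_turn (sg : R) (v : R -> R) (tau : R) : Prop :=
  0 < tau /\ v 0 = vs /\ v tau = vs /\ forall t, 0 < t < tau -> 0 < sg * (v t - vs).

Lemma signed_derive sg v r t : trajectory s b v r -> 0 <= t ->
  is_derive (fun u => sg * (v u - vs)) t (sg * v_rhs s (v t) (r t)).
Proof.
  intros h ht. destruct (h t ht) as [_ [_ [d _]]].
  auto_derive; [eexists; exact d|].
  replace (Derive (fun x => v x) t) with (v_rhs s (v t) (r t)) by (symmetry; apply is_derive_unique, d).
  ring.
Qed.

Lemma v_rhs_section r : v_rhs s vs r = (1 - vs ^ 2) * (1 - s) * (r - rs).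
Proof. unfold v_rhs. rewrite <- ers. ring. Qed.

Lemma section_speed_pos : 0 < (1 - vs ^ 2) * (1 - s).
Proof. apply Rmult_lt_0_compat; nra. Qed.

(** The return cannot be made while moving away from the section, which gives the weak inequality;
    equality would place the orbit at the equilibrium. *)
Lemma half_turn_end sg v r tau : trajectory s b v r -> half_turn sg v tau ->
  0 < sg * (r 0 - rs) -> 0 < sg * (rs - r tau).
Proof.
  intros h [htau [v0 [v1 hp]]] h0.
  assert (hle : 0 <= sg * (rs - r tau)).
  { apply Rnot_lt_le. intros hn.
    assert (hd := signed_derive sg v r tau h ltac:(lra)).
    rewrite v1, v_rhs_section in hd.
    destruct (derive_pos_left _ _ _ hd) as [d [hd1 hd2]].
    - assert (q := section_speed_pos). nra.
    - assert (hm1 := Rmax_l 0 (tau - d)). assert (hm2 := Rmax_r 0 (tau - d)).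
      assert (hm3 : Rmax 0 (tau - d) < tau) by (apply Rmax_lub_lt; lra).
      specialize (hd2 ((Rmax 0 (tau - d) + tau) / 2) ltac:(lra)).
      specialize (hp ((Rmax 0 (tau - d) + tau) / 2) ltac:(lra)).
      rewrite v1, Rminus_diag in hd2. lra. }
  destruct (Req_dec (sg * (rs - r tau)) 0) as [e|e]; [exfalso|lra].
  assert (hr0 : r 0 <> rs) by (intros k; rewrite k in h0; lra).
  destruct (trajectory_avoids v r h (or_intror hr0)) as [eta [he hav]].
  specialize (hav tau ltac:(lra)). rewrite v1, Rminus_diag, Rabs_R0 in hav.
  specialize (hav ltac:(lra)).
  destruct (Rmult_integral _ _ e) as [k|k].
  - rewrite k in h0. lra.
  - replace (r tau - rs) with 0 in hav by lra. rewrite Rabs_R0 in hav. lra.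
Qed.

Lemma half_turn_exists sg v r : sg = 1 \/ sg = -1 -> trajectory s b v r -> v 0 = vs ->
  0 < sg * (r 0 - rs) -> exists tau, half_turn sg v tau.
Proof.
  intros hsg h v0 h0.
  assert (hd := signed_derive sg v r 0 h (Rle_refl 0)).
  rewrite v0, v_rhs_section in hd.
  destruct (derive_pos_right _ _ _ hd) as [d [hd1 hd2]].
  { assert (q := section_speed_pos). nra. }
  rewrite v0, Rminus_diag, Rmult_0_r in hd2.
  assert (hr0 : r 0 <> rs) by (intros k; rewrite k in h0; lra).
  destruct (trajectory_avoids v r h (or_intror hr0)) as [eta [he hav]].
  assert (hT : exists T, 0 < T /\ sg * (v T - vs) <= 0).
  { apply NNPP. intros hn.
    assert (hall : forall t, 0 < t -> 0 < sg * (v t - vs)).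
    { intros t ht. apply Rnot_le_lt. intros q. apply hn. now exists t. }
    destruct hsg as [e|e]; rewrite e in *.
    - apply (leaves_right s b vs rs hs hb hb2 hvs hrs evs ers v r eta h he hav v0).
      intros t ht. specialize (hall t ht). lra.
    - apply (leaves_left s b vs rs hs hb hvs hrs evs ers v r eta h he hav v0); [lra|].
      intros t ht. specialize (hall t ht). lra. }
  destruct hT as [T [hT hT']].
  assert (hdT : d <= T).
  { apply Rnot_lt_le. intros k. specialize (hd2 T ltac:(lra)). lra. }
  (* The search starts at [d / 2] because the function vanishes at time 0. *)
  destruct (first_zero (fun t => sg * (v t - vs)) (d / 2) T) as [tau [k1 [k2 k3]]]; try lra.
  - intros t ht. eapply is_derive_continuous, (signed_derive sg v r t h); lra.
  - apply hd2; lra.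
  - exists tau. split; [lra|]. split; [exact v0|]. split.
    + destruct hsg as [e|e]; rewrite e in k2; lra.
    + intros t ht. destruct (Rlt_le_dec t (d / 2)) as [q|q]; [apply hd2; lra|apply k3; lra].
Qed.

(* Both crossings of the section are transversal, so the crossing time depends
   continuously on the starting point. *)
Lemma half_turn_continuous sg v r tau : sg = 1 \/ sg = -1 ->
  trajectory s b v r -> half_turn sg v tau -> 0 < sg * (r 0 - rs) ->
  forall eps, 0 < eps -> exists delta, 0 < delta /\ forall v' r' tau',
    trajectory s b v' r' -> half_turn sg v' tau' -> Rabs (r' 0 - r 0) < delta ->
    Rabs (r' tau' - r tau) < eps.
Proof.
  intros hsg h ht h0 eps heps.
  assert (hend := half_turn_end sg v r tau h ht h0).
  destruct ht as [htau [v0 [v1 hp]]].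
  set (g := fun t => sg * (v t - vs)) in *.
  assert (hsga : forall x, Rabs (sg * x) = Rabs x).
  { intros x. rewrite Rabs_mult. destruct hsg as [e|e]; rewrite e.
    - rewrite Rabs_R1; ring.
    - replace (-1) with (- (1)) by ring. rewrite Rabs_Ropp, Rabs_R1; ring. }
  set (rho := sg * (r 0 - rs)) in *.
  set (e1 := Rmin (tau / 4) (Rmin (eps / 24) 1)).
  assert (he1 : 0 < e1) by (repeat apply Rmin_pos; lra).
  assert (he1a : e1 <= tau / 4) by apply Rmin_l.
  assert (he1b : e1 <= eps / 24) by (eapply Rle_trans; [apply Rmin_r|apply Rmin_l]).
  assert (he1c : e1 <= 1) by (eapply Rle_trans; [apply Rmin_r|apply Rmin_r]).
  (* With speed at most 6, a neighbouring orbit moves by at most [6 * rho / 100] up to time [t0], so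
     it is still drifting away from the section and cannot have returned. *)
  set (t0 := Rmin (tau / 2) (rho / 100)).
  assert (ht0 : 0 < t0) by (apply Rmin_pos; lra).
  assert (ht0a : t0 <= tau / 2) by apply Rmin_l.
  assert (ht0b : t0 <= rho / 100) by apply Rmin_r.
  assert (hmin : exists mu, 0 < mu /\ forall t, t0 <= t <= tau - e1 -> mu <= g t).
  { destruct (continuity_ab_min g t0 (tau - e1)) as [x [hx1 hx2]]; [lra| |].
    - intros c hc. apply continuity_pt_filterlim.
      eapply is_derive_continuous, (signed_derive sg v r c h); lra.
    - exists (g x). split; [apply hp; lra|exact hx1]. }
  destruct hmin as [mu [hmu hmu']].
  (* By transversality the orbit is strictly on the other side shortly after [tau], which forces
     nearby orbits to have crossed by then. *)
  assert (hneg : exists e2, 0 < e2 <= e1 /\ g (tau + e2) < 0).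
  { assert (hd := signed_derive (- sg) v r tau h ltac:(lra)).
    rewrite v1, v_rhs_section in hd.
    destruct (derive_pos_right _ _ _ hd) as [d [hd1 hd2]].
    - assert (q := section_speed_pos). nra.
    - rewrite v1, Rminus_diag, Rmult_0_r in hd2.
      assert (m1 := Rmin_l e1 (d / 2)). assert (m2 := Rmin_r e1 (d / 2)).
      exists (Rmin e1 (d / 2)).
      assert (m3 : 0 < Rmin e1 (d / 2)) by (apply Rmin_pos; lra).
      split; [lra|]. specialize (hd2 (tau + Rmin e1 (d / 2)) ltac:(lra)). unfold g. lra. }
  destruct hneg as [e2 [he2 hg2]].
  destruct (trajectory_close_abs s b hs hb (tau + 1)) as [E [hE hcl]].
  (* The three bounds exclude a return before [tau - e1], exclude one after [tau + e2], and control
     the difference in [r] at the return time. *)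
  set (k := Rmin mu (Rmin (- g (tau + e2)) (eps / 2))).
  assert (hk : 0 < k) by (repeat apply Rmin_pos; lra).
  assert (hk1 : k <= mu) by apply Rmin_l.
  assert (hk2 : k <= - g (tau + e2)) by (eapply Rle_trans; [apply Rmin_r|apply Rmin_l]).
  assert (hk3 : k <= eps / 2) by (eapply Rle_trans; [apply Rmin_r|apply Rmin_r]).
  exists (Rmin (rho / 4) (k / E)).
  split; [apply Rmin_pos; [lra|apply Rdiv_lt_0_compat; lra]|].
  intros v' r' tau' h' [htau' [v0' [v1' hp']]] hclose.
  assert (hc1 : Rabs (r' 0 - r 0) < rho / 4) by (eapply Rlt_le_trans; [exact hclose|apply Rmin_l]).
  assert (hc2 : E * Rabs (r' 0 - r 0) < k).
  { assert (q : Rabs (r' 0 - r 0) < k / E) by (eapply Rlt_le_trans; [exact hclose|apply Rmin_r]).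
    apply (Rmult_lt_compat_l E) in q; [|lra].
    replace (E * (k / E)) with k in q by (field; lra). exact q. }
  assert (hnear : forall t, 0 <= t <= tau + 1 ->
    Rabs (sg * (v' t - vs) - g t) < k /\ Rabs (r' t - r t) < k).
  { intros t ht. destruct (hcl v r v' r' t h h' ltac:(lra) ht) as [q1 q2].
    unfold g. replace (sg * (v' t - vs) - sg * (v t - vs)) with (sg * (v' t - v t)) by ring.
    rewrite hsga. lra. }
  assert (hA : t0 < tau').
  { apply Rnot_le_lt. intros hle.
    assert (q : sg * (v' (tau' / 2) - vs) + 0 * (tau' - tau' / 2) <= sg * (v' tau' - vs)).
    { apply (derive_ge (fun u => sg * (v' u - vs)) (fun u => sg * v_rhs s (v' u) (r' u)));
        [lra|intros u hu; apply (signed_derive sg v' r' u h'); lra|].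
      intros u hu. destruct (h' u ltac:(lra)) as [qv [qr _]].
      destruct (trajectory_lipschitz s b hs hb v' r' 0 u h' ltac:(lra)) as [l1 l2].
      rewrite <- hsga in l1, l2, hc1.
      rewrite v0' in l1.
      apply Rabs_le_between in l1. apply Rabs_le_between in l2. apply Rabs_def2 in hc1.
      unfold v_rhs.
      replace (sg * ((1 - v' u ^ 2) * ((1 - s) * r' u - 3 * s * v' u)))
        with ((1 - v' u ^ 2) * ((1 - s) * (sg * (r' u - r' 0) + sg * (r' 0 - r 0) + rho)
           - 3 * s * (sg * (v' u - vs))))
        by (unfold rho; replace (3 * s * (sg * (v' u - vs))) with (sg * (3 * s * v' u) - sg * (3 * s * vs)) by ring; rewrite <- ers; ring).
      apply Rmult_le_pos; [nra|].
      set (x := sg * (r' u - r' 0)) in *. set (y := sg * (r' 0 - r 0)) in *.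
      set (z := sg * (v' u - vs)) in *.
      assert (x + y + rho >= rho / 2) by lra.
      assert ((1 - s) * (x + y + rho) >= 3/4 * (rho / 2)) by nra.
      assert (z <= rho / 10) by lra.
      assert (3 * s * z <= 3 / 4 * (rho / 10)) by nra.
      lra. }
    specialize (hp' (tau' / 2) ltac:(lra)). rewrite v1', Rminus_diag in q. lra. }
  assert (hB : tau - e1 < tau').
  { apply Rnot_le_lt. intros hle.
    destruct (hnear tau' ltac:(lra)) as [q _].
    rewrite v1', Rminus_diag, Rmult_0_r in q. apply Rabs_def2 in q.
    specialize (hmu' tau' ltac:(lra)). lra. }
  assert (hC : tau' < tau + e2).
  { apply Rnot_le_lt. intros hle.
    destruct (hnear (tau + e2) ltac:(lra)) as [q _]. apply Rabs_def2 in q.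
    destruct (Req_dec tau' (tau + e2)) as [e|e].
    - rewrite <- e, v1', Rminus_diag, Rmult_0_r in q. rewrite e in q. lra.
    - specialize (hp' (tau + e2) ltac:(lra)). lra. }
  destruct (hnear tau' ltac:(lra)) as [_ q].
  assert (hl : Rabs (r tau' - r tau) <= 6 * e1).
  { destruct (Rle_lt_dec tau tau') as [c|c].
    - destruct (trajectory_lipschitz s b hs hb v r tau tau' h ltac:(lra)). lra.
    - destruct (trajectory_lipschitz s b hs hb v r tau' tau h ltac:(lra)).
      rewrite Rabs_minus_sym. lra. }
  replace (r' tau' - r tau) with ((r' tau' - r tau') + (r tau' - r tau)) by ring.
  apply Rle_lt_trans with (1 := Rabs_triang _ _). lra.
Qed.

End ReturnMap.

(** * Composition of the half turns and the fixed point *)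

Section FixedPoint.

Variables s b vs rs : R.
Hypotheses (hs : 0 < s < 1 / 4) (hb : (1 - s) / 3 < b < 1 / 3).
Hypothesis hb2 : (5 - 2 * s) * (b + 1) < 6.
Hypotheses (hvs : 0 < vs < 1) (hrs : 0 < rs < 1).
Hypotheses (evs : 3 * s * (1 - 2 * b) * vs ^ 2 = 3 * b - 1 + s)
  (ers : (1 - s) * rs = 3 * s * vs).
Hypothesis htr : (1 - vs ^ 2) * (1 - b * rs ^ 2) < 2 * b * vs ^ 2 * (1 - rs ^ 2).

(** A relation, so that no return time has to be selected; [half_map_continuous] with [a' = a] shows
    that it is single-valued where that lemma applies. *)
Definition half_map (sg a c : R) : Prop :=
  exists v r tau, trajectory s b v r /\ half_turn vs sg v tau /\ r 0 = a /\ r tau = c.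

Lemma half_map_exists sg a : sg = 1 \/ sg = -1 -> 0 < a < 1 -> 0 < sg * (a - rs) ->
  exists c, half_map sg a c.
Proof.
  intros hsg ha hp.
  destruct (trajectory_exists s b hs hb vs a hvs ha) as [v [r [h [v0 r0]]]].
  destruct (half_turn_exists s b vs rs hs hb hb2 hvs hrs evs ers htr sg v r hsg h v0)
    as [tau ht].
  - rewrite r0. exact hp.
  - exists (r tau), v, r, tau. auto.
Qed.

Lemma half_map_end sg a c : half_map sg a c -> 0 < sg * (a - rs) ->
  0 < c < 1 /\ 0 < sg * (rs - c).
Proof.
  intros [v [r [tau [h [ht [r0 r1]]]]]] hp. subst.
  split.
  - destruct (h tau) as [_ [q _]]; [destruct ht; lra|exact q].
  - now apply (half_turn_end s b vs rs hs hb hvs hrs evs ers htr sg v r).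
Qed.

Lemma half_map_continuous sg a c : sg = 1 \/ sg = -1 -> half_map sg a c ->
  0 < sg * (a - rs) -> forall eps, 0 < eps -> exists delta, 0 < delta /\
  forall a' c', half_map sg a' c' -> Rabs (a' - a) < delta -> Rabs (c' - c) < eps.
Proof.
  intros hsg [v [r [tau [h [ht [r0 r1]]]]]] hp eps heps. subst.
  destruct (half_turn_continuous s b vs rs hs hb hvs hrs evs ers htr sg v r tau hsg h ht hp
    eps heps) as [d [hd hd']].
  exists d. split; [exact hd|].
  intros a' c' [v' [r' [tau' [h' [ht' [r0' r1']]]]]] hc. subst. now apply (hd' v').
Qed.

Definition return_map (a c : R) : Prop :=
  exists m, half_map 1 a m /\ half_map (-1) m c.

Lemma return_map_exists a : rs < a < 1 -> exists c, return_map a c.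
Proof.
  intros ha.
  destruct (half_map_exists 1 a (or_introl eq_refl)) as [m hm]; [lra|lra|].
  destruct (half_map_end 1 a m hm) as [q1 q2]; [lra|].
  destruct (half_map_exists (-1) m (or_intror eq_refl)) as [c hc]; [lra|lra|].
  exists c, m. auto.
Qed.

Lemma return_map_end a c : return_map a c -> rs < a -> rs < c <= r_cap s vs rs.
Proof.
  intros [m [hm hc]] ha.
  destruct (half_map_end 1 a m hm) as [q1 q2]; [lra|].
  destruct (half_map_end (-1) m c hc) as [q3 q4]; [lra|].
  split; [lra|].
  destruct hc as [v [r [tau [h [[htau [v0 [v1 hp]]] [r0 r1]]]]]]. subst.
  apply (r_le_cap s b vs rs hs hb hvs hrs ers v r tau h); [lra| |lra].
  intros u hu. destruct (Req_dec u 0) as [e|e]; [subst; lra|].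
  destruct (Req_dec u tau) as [e'|e']; [subst; lra|].
  specialize (hp u ltac:(lra)). lra.
Qed.

Lemma return_map_continuous a c : return_map a c -> rs < a ->
  forall eps, 0 < eps -> exists delta, 0 < delta /\
  forall a' c', return_map a' c' -> Rabs (a' - a) < delta -> Rabs (c' - c) < eps.
Proof.
  intros [m [hm hc]] ha eps heps.
  destruct (half_map_end 1 a m hm) as [q1 q2]; [lra|].
  destruct (half_map_continuous (-1) m c (or_intror eq_refl) hc ltac:(lra) eps heps)
    as [d1 [hd1 hd1']].
  destruct (half_map_continuous 1 a m (or_introl eq_refl) hm ltac:(lra) d1 hd1)
    as [d [hd hd']].
  exists d. split; [exact hd|]. intros a' c' [m' [hm' hc']] hcl.
  apply (hd1' m' c' hc'), (hd' a' m' hm' hcl).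
Qed.

(** The orbit of the first half turn already exists for all later times; by uniqueness its shift
    coincides with the orbit of the second, so nothing is concatenated. *)
Lemma return_map_trajectory a c : return_map a c -> exists v r T,
  trajectory s b v r /\ 0 < T /\ v 0 = vs /\ r 0 = a /\ v T = vs /\ r T = c.
Proof.
  intros [m [[v [r [t1 [h [[p1 [p2 [p3 _]]] [r0 r1]]]]]]
    [v' [r' [t2 [h' [[p1' [p2' [p3' _]]] [r0' r1']]]]]]]].
  exists v, r, (t2 + t1). split; [exact h|]. split; [lra|].
  split; [exact p2|]. split; [exact r0|].
  assert (hsh := trajectory_shift s b v r t1 ltac:(lra) h).
  destruct (trajectory_unique s b hs hb v' r' _ _ t2 h' hsh) as [q1 q2].
  - rewrite Rplus_0_l. congruence.
  - rewrite Rplus_0_l. congruence.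
  - lra.
  - split; congruence.
Qed.

(** On the section [Q] is [k * (r - rs) ^ 2]. An orbit starting at a small level returns at no
    smaller level, and above [rs], hence no closer to it. *)
Lemma return_map_expands : exists lo, rs < lo < 1 /\ forall c, return_map lo c -> lo <= c.
Proof.
  destruct (equilibrium_repels s b vs rs hs hb hvs hrs evs ers htr)
    as [Q [m [C [k [q0 [hm [hC [hk [hq0 [_ [hQ0 hinv]]]]]]]]]]].
  set (x := Rmin ((1 - rs) / 2) (q0 / k)).
  assert (hx : 0 < x) by (apply Rmin_pos; [lra|apply Rdiv_lt_0_compat; lra]).
  assert (hx1 : x <= (1 - rs) / 2) by apply Rmin_l.
  assert (hx2 : k * x <= q0).
  { assert (q : x <= q0 / k) by apply Rmin_r.
    apply (Rmult_le_compat_l k) in q; [|lra].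
    replace (k * (q0 / k)) with q0 in q by (field; lra). exact q. }
  exists (rs + x). split; [lra|]. intros c hc.
  assert (hend := return_map_end _ _ hc ltac:(lra)).
  destruct (return_map_trajectory _ _ hc) as [v [r [T [h [hT [v0 [r0 [v1 r1]]]]]]]].
  assert (hx3 : k * x ^ 2 <= q0) by (simpl; nra).
  assert (q := hinv v r T (k * x ^ 2) h ltac:(lra) hx3).
  rewrite v0, r0, v1, r1, Rminus_diag, !hQ0 in q.
  replace (rs + x - rs) with x in q by ring. specialize (q (Rle_refl _)).
  apply Rmult_le_reg_l in q; [|exact hk].
  apply Rnot_lt_le. intros hlt. nra.
Qed.

Lemma return_map_fixed_point : exists a, rs < a < 1 /\ return_map a a.
Proof.
  destruct return_map_expands as [lo [hlo hexp]].
  assert (hcap := r_cap_lt_1 s vs rs hrs).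
  set (hi := Rmax lo (r_cap s vs rs)).
  assert (hhi1 : lo <= hi) by apply Rmax_l.
  assert (hhi2 : r_cap s vs rs <= hi) by apply Rmax_r.
  assert (hhi3 : hi < 1) by (apply Rmax_lub_lt; lra).
  set (P := fun a => epsilon (inhabits 0) (return_map a)).
  assert (hP : forall a, rs < a < 1 -> return_map a (P a)).
  { intros a ha. apply epsilon_spec. now apply return_map_exists. }
  (* [first_zero] wants a strict sign at the left end; in the case of equality [lo] is already a
     fixed point. *)
  destruct (Rle_lt_or_eq_dec _ _ (hexp _ (hP lo hlo))) as [hl|hl].
  - destruct (first_zero (fun a => P a - a) lo hi hhi1) as [a [ha1 [ha2 _]]].
    + intros a ha. apply (continuous_minus P (fun a => a)); [|apply continuous_id].
      apply filterlim_locally. intros eps.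
      destruct (return_map_continuous a (P a) (hP a ltac:(lra)) ltac:(lra) eps (cond_pos eps))
        as [d [hd hd']].
      (* The neighbourhood is cut down to ([rs], 1), where the chosen value [P a] is known to
         satisfy the relation. *)
      assert (hm : 0 < Rmin d (Rmin (a - rs) (1 - a))) by (repeat apply Rmin_pos; lra).
      assert (m1 := Rmin_l d (Rmin (a - rs) (1 - a))).
      assert (m2 := Rmin_r d (Rmin (a - rs) (1 - a))).
      assert (m3 := Rmin_l (a - rs) (1 - a)). assert (m4 := Rmin_r (a - rs) (1 - a)).
      exists (mkposreal _ hm). intros y hy.
      change (Rabs (y - a) < Rmin d (Rmin (a - rs) (1 - a))) in hy.
      assert (hy' := hy). apply Rabs_def2 in hy'.
      apply (hd' y (P y)); [apply hP|]; lra.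
    + lra.
    + assert (q := return_map_end hi (P hi) (hP hi ltac:(lra)) ltac:(lra)). lra.
    + exists a. split; [lra|]. assert (q := hP a ltac:(lra)).
      replace (P a) with a in q by lra. exact q.
  - exists lo. split; [exact hlo|]. assert (q := hP lo hlo). rewrite <- hl in q. exact q.
Qed.

Theorem periodic_trajectory : exists v r T, trajectory s b v r /\ 0 < T /\
  (forall t, 0 <= t -> v (t + T) = v t /\ r (t + T) = r t) /\
  (forall t, 0 <= t -> v t <> vs \/ r t <> rs).
Proof.
  destruct return_map_fixed_point as [a [ha hfix]].
  destruct (return_map_trajectory _ _ hfix) as [v [r [T [h [hT [v0 [r0 [v1 r1]]]]]]]].
  exists v, r, T. split; [exact h|]. split; [exact hT|]. split.
  - intros t ht.
    apply (trajectory_unique s b hs hb v r (fun t => v (t + T)) (fun t => r (t + T)) t h); auto.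
    + apply trajectory_shift; [lra|exact h].
    + rewrite Rplus_0_l. congruence.
    + rewrite Rplus_0_l. congruence.
  - intros t ht.
    destruct (trajectory_avoids s b vs rs hs hb hvs hrs evs ers htr v r h) as [eta [he hav]].
    + right. lra.
    + destruct (Req_dec (v t) vs) as [e|e]; [|now left]. right. intros er.
      specialize (hav t ht). rewrite e, er, !Rminus_diag, Rabs_R0 in hav. lra.
Qed.

End FixedPoint.

(** * The trace condition and the periodic orbit *)

(* Up to a positive factor, minus the trace of the Jacobian at the equilibrium. *)
Definition trace_poly (b s : R) : R :=
  (1 - 6 * b + 17 * b ^ 2) * s ^ 2 + (- 2 + 9 * b - 22 * b ^ 2 + 33 * b ^ 3) * s
  + (1 - 3 * b - 4 * b ^ 2 + 12 * b ^ 3).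

(** As a quadratic in [Sp], [F] is [trace_poly] with the square completed, that is, multiplied by
    four times its leading coefficient. *)
Lemma F_factor gam Sp :
  F gam Sp = 4 * (1 - 6 * (gam - 1) + 17 * (gam - 1) ^ 2) * trace_poly (gam - 1) (- Sp).
Proof. unfold F, trace_poly. ring. Qed.

(* [trace_poly] is convex in [b], vanishes at [b0] and is negative at [1/3]. *)
Lemma trace_poly_neg b0 b s : 0 < s < 1 / 4 -> (1 - s) / 3 < b0 -> b0 < b < 1 / 3 ->
  trace_poly b0 s = 0 -> trace_poly b s < 0.
Proof.
  intros hs hb0 hb h0.
  set (dd := (12 + 33 * s) * (b0 + b + 1 / 3) + (- 4 - 22 * s + 17 * s ^ 2)).
  assert (hdd : 0 < dd).
  { unfold dd. assert (0 <= s ^ 2) by apply pow2_ge_0.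
    assert ((12 + 33 * s) * (5 / 6) <= (12 + 33 * s) * (b0 + b + 1 / 3))
      by (apply Rmult_le_compat_l; lra). lra. }
  (* Interpolation at [b0], [b], [1 / 3]: [dd] is the second divided difference of the cubic, and
     [s * (8 * s - 2) / 9] is its value at [1 / 3]. *)
  assert (e : (1 / 3 - b0) * trace_poly b s
     = (b - b0) * (s * (8 * s - 2) / 9) + (1 / 3 - b) * trace_poly b0 s
       - (1 / 3 - b0) * (b - b0) * (1 / 3 - b) * dd)
    by (unfold trace_poly, dd; field).
  rewrite h0 in e.
  assert (p1 : 0 < (1 / 3 - b0) * (b - b0) * (1 / 3 - b) * dd)
    by (repeat apply Rmult_lt_0_compat; try lra; exact hdd).
  assert (p2 : 0 < (b - b0) * (s * (2 - 8 * s) / 9)).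
  { apply Rmult_lt_0_compat; [lra|].
    assert (0 < s * (2 - 8 * s)) by (apply Rmult_lt_0_compat; lra). lra. }
  assert (p3 : (1 / 3 - b0) * trace_poly b s < 0) by lra.
  apply Rnot_le_lt. intros hn.
  assert (0 <= (1 / 3 - b0) * trace_poly b s) by (apply Rmult_le_pos; lra). lra.
Qed.

(** The equilibrium equations express [vs ^ 2] and [rs ^ 2] rationally in [s] and [b]; after
    clearing denominators the trace becomes [- (1 + 2 * s) * trace_poly b s]. *)
Lemma trace_condition s b vs rs : 0 < s < 1 / 4 -> b < 1 / 3 ->
  3 * s * (1 - 2 * b) * vs ^ 2 = 3 * b - 1 + s -> (1 - s) * rs = 3 * s * vs ->
  trace_poly b s < 0 ->
  (1 - vs ^ 2) * (1 - b * rs ^ 2) < 2 * b * vs ^ 2 * (1 - rs ^ 2).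
Proof.
  intros hs hb evs ers hM.
  set (X := 2 * b * vs ^ 2 * (1 - rs ^ 2) - (1 - vs ^ 2) * (1 - b * rs ^ 2)).
  cut (0 < X); [unfold X; lra|].
  set (w := vs ^ 2) in *. set (c := 3 * b - 1 + s) in *.
  assert (eR : (1 - s) ^ 2 * rs ^ 2 = 9 * s ^ 2 * w).
  { replace ((1 - s) ^ 2 * rs ^ 2) with (((1 - s) * rs) ^ 2) by ring. rewrite ers. unfold w. ring. }
  assert (e : 3 * s * (1 - s) ^ 2 * (1 - 2 * b) ^ 2 * X = - ((1 + 2 * s) * trace_poly b s)).
  { replace (3 * s * (1 - s) ^ 2 * (1 - 2 * b) ^ 2 * X)
      with (3 * s * (1 - 2 * b) ^ 2 *
        ((1 - s) ^ 2 * ((2 * b + 1) * w - 1) - (3 * b * w - b) * ((1 - s) ^ 2 * rs ^ 2)))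
      by (unfold X; ring).
    rewrite eR.
    replace (3 * s * (1 - 2 * b) ^ 2 *
        ((1 - s) ^ 2 * ((2 * b + 1) * w - 1) - (3 * b * w - b) * (9 * s ^ 2 * w)))
      with ((2 * b + 1) * (1 - 2 * b) * (1 - s) ^ 2 * (3 * s * (1 - 2 * b) * w)
        - 3 * s * (1 - s) ^ 2 * (1 - 2 * b) ^ 2
        - 9 * b * s * (3 * s * (1 - 2 * b) * w) ^ 2
        + 9 * b * s ^ 2 * (1 - 2 * b) * (3 * s * (1 - 2 * b) * w)) by ring.
    rewrite evs. unfold c, trace_poly. ring. }
  assert (h1 : 0 < (1 + 2 * s) * - trace_poly b s) by (apply Rmult_lt_0_compat; lra).
  assert (h2 : 0 < 3 * s * (1 - s) ^ 2 * (1 - 2 * b) ^ 2).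
  { repeat apply Rmult_lt_0_compat; try lra. }
  apply Rmult_lt_reg_l with (1 := h2). rewrite e. lra.
Qed.

(** * Continuation of a forward periodic function to the whole line *)

Section PeriodicExtension.

Variables (f : R -> R) (P : R).
Hypotheses (hP : 0 < P) (hf : forall t, 0 <= t -> f (t + P) = f t).

(** [up] exceeds its argument strictly, so the shifted time is positive and one shift serves a whole
    neighbourhood of [t]; this yields two-sided derivatives. *)
Definition periodic_extension (t : R) : R := f (t + P * IZR (up (- t / P))).

Lemma periodic_nat n t : 0 <= t -> f (t + P * INR n) = f t.
Proof.
  intros ht. induction n as [|n IH].
  - simpl. f_equal. ring.
  - rewrite S_INR. replace (t + P * (INR n + 1)) with (t + P * INR n + P) by ring.
    rewrite hf; [exact IH|]. assert (q := pos_INR n).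
    assert (0 <= P * INR n) by (apply Rmult_le_pos; lra). lra.
Qed.

Lemma periodic_int (j k : Z) t : 0 <= t + P * IZR j -> 0 <= t + P * IZR k ->
  f (t + P * IZR j) = f (t + P * IZR k).
Proof.
  assert (H : forall j k : Z, (j <= k)%Z -> 0 <= t + P * IZR j ->
    f (t + P * IZR k) = f (t + P * IZR j)).
  { intros j' k' hjk hj.
    rewrite <- (periodic_nat (Z.to_nat (k' - j')) _ hj).
    f_equal. rewrite INR_IZR_INZ, Z2Nat.id by lia. rewrite minus_IZR. ring. }
  intros hj hk. destruct (Z.le_ge_cases j k) as [h|h].
  - symmetry. now apply H.
  - now apply H.
Qed.

Lemma shift_pos t : 0 < t + P * IZR (up (- t / P)).
Proof.
  destruct (archimed (- t / P)) as [q _].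
  apply (Rmult_lt_compat_l P) in q; [|lra].
  replace (P * (- t / P)) with (- t) in q by (field; lra). lra.
Qed.

Lemma periodic_extension_eq k t : 0 <= t + P * IZR k ->
  periodic_extension t = f (t + P * IZR k).
Proof. intros hk. apply periodic_int; [left; apply shift_pos|exact hk]. Qed.

Lemma periodic_extension_period t : periodic_extension (t + P) = periodic_extension t.
Proof.
  assert (q := shift_pos (t + P)).
  unfold periodic_extension at 1.
  replace (t + P + P * IZR (up (- (t + P) / P))) with (t + P * IZR (1 + up (- (t + P) / P))) in *
    by (rewrite plus_IZR; ring).
  symmetry. apply periodic_extension_eq. lra.
Qed.

Lemma periodic_extension_derive (df : R -> R) t :
  (forall u, 0 <= u -> is_derive f u (df u)) ->
  is_derive periodic_extension t (df (t + P * IZR (up (- t / P)))).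
Proof.
  intros hd. assert (q := shift_pos t). set (k := up (- t / P)) in *.
  apply is_derive_ext_loc with (fun u => f (u + P * IZR k)).
  - exists (mkposreal _ q). intros u hu.
    change (Rabs (u - t) < t + P * IZR k) in hu. apply Rabs_def2 in hu.
    symmetry. apply periodic_extension_eq. lra.
  - replace (df (t + P * IZR k)) with (1 * df (t + P * IZR k)) by ring.
    apply (is_derive_comp f (fun u => u + P * IZR k)); [apply hd; lra|].
    auto_derive; [exact I|ring].
Qed.

End PeriodicExtension.

(* [x = - v r], [rho = r^2 (1 - v^2)], so that [V^2 = r^2], on the invariant plane
   [theta = - PI / 2], where [1 + sin theta = 0 = cos theta]. *)
Definition lift (v r : R) : state := State (- (v * r)) (r ^ 2 * (1 - v ^ 2)) (- (PI / 2)).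

Section Lift.

Variables s b v r : R.
Hypotheses (hs : 0 < s < 1 / 4) (hb : (1 - s) / 3 < b < 1 / 3).
Hypotheses (hv : 0 < v < 1) (hr : 0 < r < 1).

(** The right side is the derivative of [- (v * r)] along the planar field; [lift_rho_rhs] does the
    same for [r ^ 2 * (1 - v ^ 2)]. *)
Lemma lift_x_rhs : x_rhs (b + 1) (- s) (lift v r)
  = - (v_rhs s v r * r + v * r_rhs s b v r).
Proof.
  assert (hd := den_bound s b hs hb r ltac:(lra)).
  unfold x_rhs, T, VsqS, Vsq, Astar, lift. simpl sx. simpl srho. simpl stheta.
  rewrite cos_neg, cos_PI2.
  replace ((- (v * r)) ^ 2 + r ^ 2 * (1 - v ^ 2)) with (r ^ 2) by ring.
  replace (b + 1 - 1) with b by ring.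
  unfold v_rhs, r_rhs, growth. field. lra.
Qed.

Lemma lift_rho_rhs : rho_rhs (b + 1) (- s) (lift v r)
  = 2 * r * r_rhs s b v r * (1 - v ^ 2) - 2 * r ^ 2 * v * v_rhs s v r.
Proof.
  assert (hd := den_bound s b hs hb r ltac:(lra)).
  unfold rho_rhs, T, VsqS, Vsq, Astar, lift. simpl sx. simpl srho. simpl stheta.
  rewrite cos_neg, cos_PI2.
  replace ((- (v * r)) ^ 2 + r ^ 2 * (1 - v ^ 2)) with (r ^ 2) by ring.
  replace (b + 1 - 1) with b by ring.
  unfold v_rhs, r_rhs, growth. field. lra.
Qed.

Lemma lift_theta_rhs : theta_rhs (- s) 1 (lift v r) = 0.
Proof. unfold theta_rhs, lift. simpl stheta. rewrite sin_neg, sin_PI2. ring. Qed.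

Lemma lift_in_state_space : in_state_space (lift v r).
Proof.
  unfold in_state_space, Vsq, lift. simpl sx. simpl srho.
  replace ((- (v * r)) ^ 2 + r ^ 2 * (1 - v ^ 2)) with (r ^ 2) by ring.
  split; [apply Rmult_le_pos; nra|nra].
Qed.

Lemma lift_not_equilibrium vs rs : 0 < vs ->
  3 * s * (1 - 2 * b) * vs ^ 2 = 3 * b - 1 + s -> (1 - s) * rs = 3 * s * vs ->
  v <> vs \/ r <> rs -> ~ is_equilibrium (b + 1) (- s) 1 (lift v r).
Proof.
  intros hvs evs ers hne [_ [hx [hrho _]]].
  rewrite lift_x_rhs in hx. rewrite lift_rho_rhs in hrho.
  (* Half the derivative of [V^2 = r^2], recovered as half of [rho'] plus [x] times [x']. *)
  assert (e1 : r * r_rhs s b v r = 0).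
  { replace (r * r_rhs s b v r) with
      ((2 * r * r_rhs s b v r * (1 - v ^ 2) - 2 * r ^ 2 * v * v_rhs s v r) / 2
        - v * r * - (v_rhs s v r * r + v * r_rhs s b v r)) by field.
    rewrite hx, hrho. field. }
  assert (e2 : r_rhs s b v r = 0) by (apply Rmult_integral in e1; destruct e1; lra).
  rewrite e2 in hx.
  assert (e3 : v_rhs s v r = 0).
  { assert (q : v_rhs s v r * r = 0) by lra. apply Rmult_integral in q. destruct q; lra. }
  assert (e4 : (1 - s) * r - 3 * s * v = 0).
  { unfold v_rhs in e3. apply Rmult_integral in e3. destruct e3; [nra|assumption]. }
  assert (e5 : growth s b v r = 0).
  { assert (hd := den_bound s b hs hb r ltac:(lra)).
    unfold r_rhs, Rdiv in e2. apply Rmult_integral in e2. destruct e2 as [q|q].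
    - assert (0 < r * (1 - r ^ 2)) by (apply Rmult_lt_0_compat; nra).
      apply Rmult_integral in q. destruct q; lra.
    - assert (q' := Rinv_0_lt_compat (1 - b * r ^ 2) ltac:(lra)). lra. }
  rewrite (growth_split s b vs evs), e4 in e5.
  assert (e6 : vs ^ 2 - v ^ 2 = 0).
  { assert (0 < 3 * s * (1 - 2 * b)) by (apply Rmult_lt_0_compat; lra).
    assert (q : 3 * s * (1 - 2 * b) * (vs ^ 2 - v ^ 2) = 0) by lra.
    apply Rmult_integral in q. destruct q; lra. }
  assert (e7 : v = vs) by nra.
  destruct hne as [n|n]; [now apply n|]. apply n. subst v.
  assert (q : (1 - s) * (r - rs) = 0) by lra.
  apply Rmult_integral in q. destruct q; lra.
Qed.

End Lift.

Theorem theorem4p4 (Sp gam g0 : R)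
  (hSp : - (1 / 4) < Sp < 0)
  (hg0 : is_gamma0 Sp g0)
  (hgam : g0 < gam < 6 / (5 + 2 * Sp)) :
  exists phi : R -> state, is_closed_periodic_orbit gam Sp 1 phi.
Proof.
  destruct hg0 as [hg0 hF].
  set (s := - Sp). set (b := gam - 1).
  replace Sp with (- s) in * by (unfold s; ring).
  replace gam with (b + 1) in * by (unfold b; ring).
  clearbody s b. clear Sp gam.
  assert (hs : 0 < s < 1 / 4) by lra.
  assert (hb2 : (5 - 2 * s) * (b + 1) < 6).
  { destruct hgam as [_ q]. apply (Rmult_lt_compat_l (5 + 2 * - s)) in q; [|lra].
    replace ((5 + 2 * - s) * (6 / (5 + 2 * - s))) with 6 in q by (field; lra). lra. }
  (* The lower bound comes from [g0 > (4 + Sp) / 3], the upper one from [hb2] and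
     [5 - 2 * s > 9 / 2]. *)
  assert (hb : (1 - s) / 3 < b < 1 / 3) by (split; [lra|nra]).
  assert (hM : trace_poly b s < 0).
  { apply trace_poly_neg with (g0 - 1); try lra.
    rewrite F_factor, Ropp_involutive in hF.
    apply Rmult_integral in hF. destruct hF as [q|q]; [exfalso|exact q].
    (* The other factor of [F] has no zero: [17 * (1 - 6 * b + 17 * b^2) = (17 * b - 3)^2 + 8], here
       with [g0 - 1] for [b]. *)
    assert (0 <= (17 * (g0 - 1) - 3) ^ 2) by apply pow2_ge_0. nra. }
  assert (hk : 0 < 3 * s * (1 - 2 * b)) by (apply Rmult_lt_0_compat; lra).
  set (w := (3 * b - 1 + s) / (3 * s * (1 - 2 * b))).
  assert (hw : 0 < w) by (apply Rdiv_lt_0_compat; lra).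
  assert (ew : 3 * s * (1 - 2 * b) * w = 3 * b - 1 + s) by (unfold w; field; lra).
  set (vs := sqrt w).
  assert (evs2 : vs ^ 2 = w) by (apply pow2_sqrt; lra).
  assert (evs : 3 * s * (1 - 2 * b) * vs ^ 2 = 3 * b - 1 + s) by (rewrite evs2; exact ew).
  assert (hvs0 : 0 < vs) by now apply sqrt_lt_R0.
  (* The denominator of [w] minus its numerator is [(1 - 3 * b) * (1 + 2 * s)]. *)
  assert (hw1 : w < 1).
  { apply Rmult_lt_reg_l with (1 := hk). rewrite ew.
    assert (0 < (1 - 3 * b) * (1 + 2 * s)) by (apply Rmult_lt_0_compat; lra). lra. }
  assert (hvs : 0 < vs < 1) by (split; [exact hvs0|nra]).
  set (rs := 3 * s * vs / (1 - s)).
  assert (ers : (1 - s) * rs = 3 * s * vs) by (unfold rs; field; lra).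
  assert (hrs : 0 < rs < 1) by (split; nra).
  assert (htr := trace_condition s b vs rs hs (proj2 hb) evs ers hM).
  destruct (periodic_trajectory s b vs rs hs hb hb2 hvs hrs evs ers htr)
    as [v [r [P [h [hP [hper hne]]]]]].
  assert (hpv : forall t, 0 <= t -> v (t + P) = v t) by (intros t ht; now apply hper).
  assert (hpr : forall t, 0 <= t -> r (t + P) = r t) by (intros t ht; now apply hper).
  set (V := periodic_extension v P). set (Q := periodic_extension r P).
  assert (hVQ : forall t, 0 < V t < 1 /\ 0 < Q t < 1 /\
    is_derive V t (v_rhs s (V t) (Q t)) /\ is_derive Q t (r_rhs s b (V t) (Q t)) /\
    (V t <> vs \/ Q t <> rs)).
  { intros t. assert (q := shift_pos P hP t).
    destruct (h _ (Rlt_le _ _ q)) as [h1 [h2 _]].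
    split; [exact h1|]. split; [exact h2|]. split; [|split].
    - apply (periodic_extension_derive v P hP hpv (fun u => v_rhs s (v u) (r u))).
      intros u hu. apply (h u hu).
    - apply (periodic_extension_derive r P hP hpr (fun u => r_rhs s b (v u) (r u))).
      intros u hu. apply (h u hu).
    - apply hne. lra. }
  exists (fun t => lift (V t) (Q t)). split; [|split].
  - intros t. destruct (hVQ t) as [h1 [h2 [dV [dQ _]]]].
    split; [now apply lift_in_state_space|]. split; [|split].
    + rewrite lift_x_rhs by auto. simpl.
      auto_derive; [repeat split; eexists; eassumption|].
      replace (Derive (fun x => V x) t) with (v_rhs s (V t) (Q t)) by (symmetry; apply is_derive_unique, dV).
      replace (Derive (fun x => Q x) t) with (r_rhs s b (V t) (Q t)) by (symmetry; apply is_derive_unique, dQ).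
      ring.
    + rewrite lift_rho_rhs by auto. simpl.
      auto_derive; [repeat split; eexists; eassumption|].
      replace (Derive (fun x => V x) t) with (v_rhs s (V t) (Q t)) by (symmetry; apply is_derive_unique, dV).
      replace (Derive (fun x => Q x) t) with (r_rhs s b (V t) (Q t)) by (symmetry; apply is_derive_unique, dQ).
      ring.
    + intros _. rewrite lift_theta_rhs. simpl. apply is_derive_constant.
  - exists P. split; [exact hP|]. intros t.
    unfold V, Q. rewrite (periodic_extension_period v P hP hpv), (periodic_extension_period r P hP hpr).
    repeat split. intros _. exists 0%Z. ring.
  - intros t. destruct (hVQ t) as [h1 [h2 [_ [_ hn]]]].
    now apply lift_not_equilibrium with vs rs.
Qed.
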